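(* Let $F$ be an algebraically closed field and let $X\subseteq\mathbb A^m_F$ be a power hypersurface with an isolated singularity, with equation $r_1x_1^{a_1}+\dots+r_mx_m^{a_m}=0$ ($a_i>0$, $r_i\in F$, the origin being an isolated singularity). Then there exists a polynomial $Q_X(t)\in\mathbf{Gr}(F^{\mathrm{form}})_{\mathbb L}[t]$ such that $$\mathrm{Igu}^{\mathrm{geom}}_X(t)=\frac{Q_X(t)}{(1-\mathbb L^{m-1}t)(1-\mathbb L^Nt^e)},$$ where $e$ is the least common multiple of $a_1,\dots,a_m$ and $$N=e\Big(\frac{a_1-1}{a_1}+\dots+\frac{a_m-1}{a_m}\Big).$$
   Context: $\mathcal L_F$ is the first-order language of $F$-algebras. A schemic formula is a finite conjunction of equations $f(x)=0$ with $f\in F[x]$, $x=(x_1,\dots,x_n)$; a pp-formula is $(\exists y)\psi(x,y)$ with $\psi$ schemic; $\mathcal{PP}$ is the Boolean closure of the pp-formulae. $\mathbf{Art}_F$ is the class of Artinian local $F$-algebras (finite-dimensional over $F$). For a set $\Phi$ of formulae of arity $n$ and $R\in\mathbf{Art}_F$, put $\Phi(R):=\bigcup_{\phi\in\Phi}\phi(R)\subseteq R^n$. $\Phi$ is a formulary if for each $R\in\mathbf{Art}_F$ there is $\phi\in\Phi$ with $\phi(R)=\Phi(R)$; formularies are equivalent if they define the same set in all $R\in\mathbf{Art}_F$. $\mathcal{PP}^\infty$ is the lattice (up to equivalence) of formularies consisting of formulae in $\mathcal{PP}$, with $\Phi\wedge\Psi=\{\phi\wedge\psi\}$, $\Phi\vee\Psi=\Phi\cup\Psi$.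 A schemic isomorphism $\Phi\to\Psi$ is given by a schemic formula $\theta(x,y)$ such that for each $R\in\mathbf{Art}_F$, $\theta(R)$ restricted to $\Phi(R)$ is the graph of a bijection $\Phi(R)\to\Psi(R)$, the inverses also being given by a schemic formula. $\mathbf{Gr}^\infty(F^{\mathrm{pp}})$ is the free Abelian group on $\mathcal{PP}^\infty$ modulo all $\langle\Phi\rangle-\langle\Psi\rangle$ with $\Phi,\Psi$ schemically isomorphic and all $\langle\Phi\vee\Psi\rangle+\langle\Phi\wedge\Psi\rangle-\langle\Phi\rangle-\langle\Psi\rangle$, a commutative ring with product induced by $\Phi\times\Psi=\{\phi(x)\wedge\psi(y)\}$ ($x,y$ disjoint). The class of an affine $F$-scheme of finite type is the class of a schemic formula defining it. For a closed immersion $Y\subseteq V$ of affine $F$-schemes, $V=\operatorname{Spec}B\subseteq\mathbb A^n_F$, with $Y$ defined by the ideal $I\subseteq B$, the total jet $J_YV$ is the formulary of all schemic formulae defining $\operatorname{Spec}(B/I^k)\subseteq\mathbb A^n_F$, $k\ge1$. The formal Grothendieck ring $\mathbf{Gr}(F^{\mathrm{form}})$ is the quotient of $\mathbf{Gr}^\infty(F^{\mathrm{pp}})$ by the ideal generated by all $[J_YV]-[Y]$. $\mathbb L$ is the class of the affine line and $\mathbf{Gr}(F^{\mathrm{form}})_{\mathbb L}$ is the localization inverting $\mathbb L$. For $X=\operatorname{Spec}F[x]/(f_1,\dots,f_s)$, the linear arc scheme $\nabla_nX$ is the affine scheme in the variables $\tilde x_0,\dots,\tilde x_{n-1}$ (each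 a tuple like $x$) whose equations express $f_j(\tilde x_0+\tilde x_1\xi+\dots+\tilde x_{n-1}\xi^{n-1})\equiv0\bmod\xi^n$ for all $j$. Then $\mathrm{Igu}^{\mathrm{geom}}_X(t):=\sum_n[\nabla_nX]\,t^n$, a power series over $\mathbf{Gr}(F^{\mathrm{form}})$, here viewed over $\mathbf{Gr}(F^{\mathrm{form}})_{\mathbb L}$. *)

(* Defs.v *)
From HB Require Import structures.
From mathcomp Require Import all_boot all_order all_algebra.
From mathcomp Require Import boolp ring.
From mathcomp Require Import mpoly freeg.

Set Implicit Arguments.
Unset Strict Implicit.
Unset Printing Implicit Defensive.

Import GRing.Theory.
Local Open Scope ring_scope.
Local Open Scope quotient_scope.

(* A commutative ring "up to [pr_eq]"; the quotient by [pr_eq] is a genuine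
   commutative ring.  No non-triviality (1 <> 0) is required or claimed. *)
Record preRing := PreRing {
  pr_car :> choiceType;
  pr_eq : pr_car -> pr_car -> Prop;
  pr_zero : pr_car;
  pr_opp : pr_car -> pr_car;
  pr_add : pr_car -> pr_car -> pr_car;
  pr_one : pr_car;
  pr_mul : pr_car -> pr_car -> pr_car;
  pr_refl : forall x, pr_eq x x;
  pr_sym : forall x y, pr_eq x y -> pr_eq y x;
  pr_trans : forall y x z, pr_eq x y -> pr_eq y z -> pr_eq x z;
  pr_eqN : forall x x', pr_eq x x' -> pr_eq (pr_opp x) (pr_opp x');
  pr_eqD : forall x x' y y', pr_eq x x' -> pr_eq y y' ->
    pr_eq (pr_add x y) (pr_add x' y');
  pr_eqM : forall x x' y y', pr_eq x x' -> pr_eq y y' ->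
    pr_eq (pr_mul x y) (pr_mul x' y');
  pr_addA : forall x y z,
    pr_eq (pr_add x (pr_add y z)) (pr_add (pr_add x y) z);
  pr_addC : forall x y, pr_eq (pr_add x y) (pr_add y x);
  pr_add0 : forall x, pr_eq (pr_add pr_zero x) x;
  pr_addN : forall x, pr_eq (pr_add (pr_opp x) x) pr_zero;
  pr_mulA : forall x y z,
    pr_eq (pr_mul x (pr_mul y z)) (pr_mul (pr_mul x y) z);
  pr_mulC : forall x y, pr_eq (pr_mul x y) (pr_mul y x);
  pr_mul1 : forall x, pr_eq (pr_mul pr_one x) x;
  pr_mulD : forall x y z,
    pr_eq (pr_mul (pr_add x y) z) (pr_add (pr_mul x z) (pr_mul y z)) }.

Section QuotRing.
Variable A : preRing.

Definition pr_rel (x y : A) : bool := `[< pr_eq x y >].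

Lemma pr_rel_refl : reflexive pr_rel.
Proof. by move=> x; apply/asboolP; exact: pr_refl. Qed.
Lemma pr_rel_sym : ssrbool.symmetric pr_rel.
Proof. by move=> x y; apply/asboolP/asboolP; exact: pr_sym. Qed.
Lemma pr_rel_trans : transitive pr_rel.
Proof.
by move=> y x z /asboolP xy /asboolP yz; apply/asboolP; exact: pr_trans xy yz.
Qed.

Canonical pr_equiv := EquivRel pr_rel pr_rel_refl pr_rel_sym pr_rel_trans.

Definition quotRing := {eq_quot pr_equiv}.
HB.instance Definition _ := Choice.on quotRing.
HB.instance Definition _ := EqQuotient.on quotRing.

Definition qr_pi (x : A) : quotRing := \pi_quotRing x.

Lemma qr_eqP x y : qr_pi x = qr_pi y <-> pr_eq x y.
Proof.
split=> [/eqP|xy]; first by rewrite /qr_pi piE => /asboolP.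
by apply/eqP; rewrite /qr_pi piE; apply/asboolP.
Qed.

Lemma qr_repr x : pr_eq (repr (qr_pi x)) x.
Proof. by apply/qr_eqP; rewrite /qr_pi reprK. Qed.

Definition qr_opp (x : quotRing) := qr_pi (pr_opp (repr x)).
Definition qr_add (x y : quotRing) := qr_pi (pr_add (repr x) (repr y)).
Definition qr_mul (x y : quotRing) := qr_pi (pr_mul (repr x) (repr y)).

Lemma qr_oppE x : qr_opp (qr_pi x) = qr_pi (pr_opp x).
Proof. by apply/qr_eqP/pr_eqN/qr_repr. Qed.
Lemma qr_addE x y : qr_add (qr_pi x) (qr_pi y) = qr_pi (pr_add x y).
Proof. by apply/qr_eqP/pr_eqD; exact: qr_repr. Qed.
Lemma qr_mulE x y : qr_mul (qr_pi x) (qr_pi y) = qr_pi (pr_mul x y).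
Proof. by apply/qr_eqP/pr_eqM; exact: qr_repr. Qed.

Lemma qr_ind (P : quotRing -> Prop) : (forall x, P (qr_pi x)) -> forall x, P x.
Proof. by move=> h; elim/quotW. Qed.

Lemma qr_addA : associative qr_add.
Proof.
elim/qr_ind=> x; elim/qr_ind=> y; elim/qr_ind=> z.
by rewrite !qr_addE; apply/qr_eqP/pr_addA.
Qed.
Lemma qr_addC : commutative qr_add.
Proof.
elim/qr_ind=> x; elim/qr_ind=> y; rewrite !qr_addE; exact/qr_eqP/pr_addC.
Qed.
Lemma qr_add0 : left_id (qr_pi (pr_zero A)) qr_add.
Proof. by elim/qr_ind=> x; rewrite !qr_addE; apply/qr_eqP/pr_add0. Qed.
Lemma qr_addN : left_inverse (qr_pi (pr_zero A)) qr_opp qr_add.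
Proof. by elim/qr_ind=> x; rewrite qr_oppE qr_addE; apply/qr_eqP/pr_addN. Qed.
Lemma qr_mulA : associative qr_mul.
Proof.
elim/qr_ind=> x; elim/qr_ind=> y; elim/qr_ind=> z.
by rewrite !qr_mulE; apply/qr_eqP/pr_mulA.
Qed.
Lemma qr_mulC : commutative qr_mul.
Proof.
elim/qr_ind=> x; elim/qr_ind=> y; rewrite !qr_mulE; exact/qr_eqP/pr_mulC.
Qed.
Lemma qr_mul1 : left_id (qr_pi (pr_one A)) qr_mul.
Proof. by elim/qr_ind=> x; rewrite !qr_mulE; apply/qr_eqP/pr_mul1. Qed.

HB.instance Definition _ :=
  GRing.isZmodule.Build quotRing qr_addA qr_addC qr_add0 qr_addN.

Lemma qr_mulD : left_distributive qr_mul +%R.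
Proof.
elim/qr_ind=> x; elim/qr_ind=> y; elim/qr_ind=> z.
have -> : qr_pi x + qr_pi y = qr_add (qr_pi x) (qr_pi y) by [].
rewrite qr_addE !qr_mulE.
have -> : qr_pi (pr_mul x z) + qr_pi (pr_mul y z) =
          qr_add (qr_pi (pr_mul x z)) (qr_pi (pr_mul y z)) by [].
by rewrite qr_addE; apply/qr_eqP/pr_mulD.
Qed.

HB.instance Definition _ := GRing.Zmodule_isComPzRing.Build quotRing
  qr_mulA qr_mulC qr_mul1 qr_mulD.

Lemma qr_pi0 : qr_pi (pr_zero A) = 0. Proof. by []. Qed.
Lemma qr_pi1 : qr_pi (pr_one A) = 1. Proof. by []. Qed.
Lemma qr_piN x : qr_pi (pr_opp x) = - qr_pi x.
Proof. by rewrite -qr_oppE. Qed.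
Lemma qr_piD x y : qr_pi (pr_add x y) = qr_pi x + qr_pi y.
Proof. by rewrite -qr_addE. Qed.
Lemma qr_piM x y : qr_pi (pr_mul x y) = qr_pi x * qr_pi y.
Proof. by rewrite -qr_mulE. Qed.

End QuotRing.

Inductive zspan (V : zmodType) (S : V -> Prop) : V -> Prop :=
| zspan_gen x : S x -> zspan S x
| zspan0 : zspan S 0
| zspanB x y : zspan S x -> zspan S y -> zspan S (x - y).

Inductive ideal_span (R : comPzRingType) (S : R -> Prop) : R -> Prop :=
| ideal_gen x : S x -> ideal_span S x
| ideal0 : ideal_span S 0
| idealD x y : ideal_span S x -> ideal_span S y -> ideal_span S (x + y)
| idealM a x : ideal_span S x -> ideal_span S (a * x).

Lemma zspanN (V : zmodType) (S : V -> Prop) x : zspan S x -> zspan S (- x).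
Proof. by rewrite -(sub0r x); apply/zspanB/zspan0. Qed.

Lemma zspanD (V : zmodType) (S : V -> Prop) x y :
  zspan S x -> zspan S y -> zspan S (x + y).
Proof. by move=> hx hy; rewrite -(opprK y); apply/zspanB/zspanN. Qed.

Lemma zspanC (V : zmodType) (S : V -> Prop) x y :
  zspan S (x - y) -> zspan S (y - x).
Proof. by move=> h; rewrite -opprB; apply: zspanN. Qed.

Section IdealQuot.
Variables (R : comPzRingType) (S : R -> Prop).
Let I := ideal_span S.
Let E (x y : R) := I (x - y).

Lemma ideal_spanN x : I x -> I (- x).
Proof. by rewrite -mulN1r; apply: idealM. Qed.

Lemma idealq_eq x y : x = y -> E x y.
Proof. by move=> ->; rewrite /E subrr; apply: ideal0. Qed.
Lemma idealq_sym x y : E x y -> E y x.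
Proof. by move=> /ideal_spanN; rewrite /E opprB. Qed.
Lemma idealq_trans y x z : E x y -> E y z -> E x z.
Proof.
move=> xy yz; have -> : E x z = I ((x - y) + (y - z)) by rewrite /E subrKA.
exact: idealD.
Qed.
Lemma idealq_N x x' : E x x' -> E (- x) (- x').
Proof. by move=> /ideal_spanN; rewrite /E opprD. Qed.
Lemma idealq_D x x' y y' : E x x' -> E y y' -> E (x + y) (x' + y').
Proof. by move=> hx hy; rewrite /E opprD addrACA; apply: idealD. Qed.
Lemma idealq_M x x' y y' : E x x' -> E y y' -> E (x * y) (x' * y').
Proof.
move=> hx hy; apply: (@idealq_trans (x * y')); rewrite /E.
  by rewrite -mulrBr; apply: idealM.
by rewrite -mulrBl mulrC; apply: idealM.
Qed.

Definition idealQuot_pre : preRing :=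
  @PreRing R E 0 -%R +%R 1 *%R (fun x => idealq_eq erefl)
   idealq_sym idealq_trans idealq_N idealq_D idealq_M
   (fun x y z => idealq_eq (addrA x y z)) (fun x y => idealq_eq (addrC x y))
   (fun x => idealq_eq (add0r x)) (fun x => idealq_eq (addNr x))
   (fun x y z => idealq_eq (mulrA x y z)) (fun x y => idealq_eq (mulrC x y))
   (fun x => idealq_eq (mul1r x)) (fun x y z => idealq_eq (mulrDl x y z)).

Definition idealQuot : comPzRingType := quotRing idealQuot_pre.
Definition toIdealQuot (x : R) : idealQuot := @qr_pi idealQuot_pre x.

End IdealQuot.

(* The localization of a commutative ring at the powers of s: the pair (x, k)
   stands for x / s ^ k. *)
Section Localization.
Variables (R : comPzRingType) (s : R).
Let E (p q : R * nat) :=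
  exists k, s ^+ k * (p.1 * s ^+ q.2) = s ^+ k * (q.1 * s ^+ p.2).
Let add (p q : R * nat) : R * nat :=
  (p.1 * s ^+ q.2 + q.1 * s ^+ p.2, (p.2 + q.2)%N).
Let mul (p q : R * nat) : R * nat := (p.1 * q.1, (p.2 + q.2)%N).
Let opp (p : R * nat) : R * nat := (- p.1, p.2).

Lemma locq_eq p q : p.1 * s ^+ q.2 = q.1 * s ^+ p.2 -> E p q.
Proof. by move=> h; exists 0%N; rewrite h. Qed.
Lemma locq_sym p q : E p q -> E q p.
Proof. by case=> k h; exists k. Qed.
Lemma locq_trans q p r : E p q -> E q r -> E p r.
Proof.
case: p q r => [p i] [q j] [r l] [a /= ha] [b /= hb].
exists (a + b + j)%N => /=.
have -> : s ^+ (a + b + j) * (p * s ^+ l) =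
  (s ^+ a * (p * s ^+ j)) * (s ^+ b * s ^+ l) by rewrite ?exprD; ring.
rewrite ha.
have -> : s ^+ a * (q * s ^+ i) * (s ^+ b * s ^+ l) =
  (s ^+ b * (q * s ^+ l)) * (s ^+ a * s ^+ i) by rewrite ?exprD; ring.
by rewrite hb ?exprD; ring.
Qed.
Lemma locq_N p p' : E p p' -> E (opp p) (opp p').
Proof. by case=> k h; exists k; rewrite /= !mulNr !mulrN h. Qed.
Lemma locq_D p p' q q' : E p p' -> E q q' -> E (add p q) (add p' q').
Proof.
case: p p' q q' => [x i] [x' i'] [y j] [y' j'] [a /= ha] [b /= hb].
exists (a + b)%N => /=.
have -> : s ^+ (a + b) * ((x * s ^+ j + y * s ^+ i) * s ^+ (i' + j')) =
  (s ^+ a * (x * s ^+ i')) * (s ^+ b * s ^+ j * s ^+ j') +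
  (s ^+ b * (y * s ^+ j')) * (s ^+ a * s ^+ i * s ^+ i') by rewrite ?exprD; ring.
by rewrite ha hb ?exprD; ring.
Qed.
Lemma locq_M p p' q q' : E p p' -> E q q' -> E (mul p q) (mul p' q').
Proof.
case: p p' q q' => [x i] [x' i'] [y j] [y' j'] [a /= ha] [b /= hb].
exists (a + b)%N => /=.
have -> : s ^+ (a + b) * (x * y * s ^+ (i' + j')) =
  (s ^+ a * (x * s ^+ i')) * (s ^+ b * (y * s ^+ j')) by rewrite ?exprD; ring.
by rewrite ha hb ?exprD; ring.
Qed.
Lemma locq_addA p q r : E (add p (add q r)) (add (add p q) r).
Proof. by apply: locq_eq => /=; rewrite ?exprD ?expr0; ring. Qed.
Lemma locq_addC p q : E (add p q) (add q p).
Proof. by apply: locq_eq => /=; rewrite ?exprD ?expr0; ring. Qed.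
Lemma locq_add0 p : E (add (0, 0%N) p) p.
Proof. by apply: locq_eq => /=; rewrite ?exprD ?expr0; ring. Qed.
Lemma locq_addN p : E (add (opp p) p) (0, 0%N).
Proof. by apply: locq_eq => /=; rewrite ?exprD ?expr0; ring. Qed.
Lemma locq_mulA p q r : E (mul p (mul q r)) (mul (mul p q) r).
Proof. by apply: locq_eq => /=; rewrite ?exprD ?expr0; ring. Qed.
Lemma locq_mulC p q : E (mul p q) (mul q p).
Proof. by apply: locq_eq => /=; rewrite ?exprD ?expr0; ring. Qed.
Lemma locq_mul1 p : E (mul (1, 0%N) p) p.
Proof. by apply: locq_eq => /=; rewrite ?exprD ?expr0; ring. Qed.
Lemma locq_mulD p q r : E (mul (add p q) r) (add (mul p r) (mul q r)).
Proof. by apply: locq_eq => /=; rewrite ?exprD ?expr0; ring. Qed.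

Definition localize_pre : preRing :=
  @PreRing (R * nat)%type E (0, 0%N) opp add (1, 0%N) mul
    (fun p => locq_eq erefl) locq_sym locq_trans locq_N locq_D locq_M
    locq_addA locq_addC locq_add0 locq_addN locq_mulA locq_mulC locq_mul1
    locq_mulD.

Definition localize : comPzRingType := quotRing localize_pre.
Definition toLocalize (x : R) : localize := @qr_pi localize_pre (x, 0%N).

End Localization.

(* The objects of Art_F.  Every commutative F-algebra carries the structure
   [comUnitAlgType] (classically, units are decidable); a local ring is one
   whose non-units are closed under addition, 1 <> 0 being part of the
   structure. *)
Definition finite_dim (F : fieldType) (R : comUnitAlgType F) : Prop :=
  exists d (b : 'I_d -> R), forall x, exists c : 'I_d -> F,
    x = \sum_i c i *: b i.

Definition local_ring (R : comUnitRingType) : Prop :=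
  forall x y : R, x \isn't a GRing.unit -> y \isn't a GRing.unit ->
    x + y \isn't a GRing.unit.

Record artAlg (F : fieldType) := ArtAlg {
  art_alg :> comUnitAlgType F;
  art_finite : finite_dim art_alg;
  art_local : local_ring art_alg }.

Section Formulae.
Variable F : fieldType.
Implicit Type R : artAlg F.

Definition evalp R n (x : 'rV[R]_n) (p : {mpoly F[n]}) : R :=
  mmap (in_alg R) (fun i => x 0 i) p.

(* A schemic formula: the conjunction of the equations p(x) = 0, p in s. *)
Definition schemic n := seq {mpoly F[n]}.

Definition solves R n (s : schemic n) (x : 'rV[R]_n) : bool :=
  all (fun p => evalp x p == 0) s.

(* Boolean combinations of pp-formulae in n free variables.  [PPex k s] is the
   pp-formula (exists y) s(x, y), where y is a k-tuple. *)
Inductive ppform (n : nat) :=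
| PPex (k : nat) of schemic (n + k)
| PPnot of ppform n
| PPand of ppform n & ppform n
| PPor of ppform n & ppform n.

Fixpoint holds R n (phi : ppform n) (x : 'rV[R]_n) : Prop :=
  match phi with
  | PPex k s => exists y : 'rV[R]_k, solves s (row_mx x y)
  | PPnot f => ~ holds f x
  | PPand f g => holds f x /\ holds g x
  | PPor f g => holds f x \/ holds g x
  end.

Definition points R n (Phi : ppform n -> Prop) (x : 'rV[R]_n) : Prop :=
  exists2 phi, Phi phi & holds phi x.

Record formulary (n : nat) := Formulary {
  formulae :> ppform n -> Prop;
  formularyP : forall R, exists2 phi, formulae phi &
    forall x : 'rV[R]_n, holds phi x <-> points formulae x }.

HB.instance Definition _ n := gen_eqMixin (formulary n).
HB.instance Definition _ n := gen_choiceMixin (formulary n).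

Definition rename n m (f : 'I_n -> 'I_m) (p : {mpoly F[n]}) : {mpoly F[m]} :=
  mmap (@mpolyC m F) (fun i => 'X_(f i)) p.

Definition rename_ext n m k (f : 'I_n -> 'I_m) (i : 'I_(n + k)) : 'I_(m + k) :=
  match split i with inl j => lshift k (f j) | inr j => rshift m j end.

Fixpoint pprename n m (f : 'I_n -> 'I_m) (phi : ppform n) : ppform m :=
  match phi with
  | PPex k s => PPex [seq rename (rename_ext f) p | p <- s]
  | PPnot g => PPnot (pprename f g)
  | PPand g h => PPand (pprename f g) (pprename f h)
  | PPor g h => PPor (pprename f g) (pprename f h)
  end.

Definition pullv R n m (f : 'I_n -> 'I_m) (x : 'rV[R]_m) : 'rV[R]_n :=
  \row_i x 0 (f i).

Lemma evalp_rename R n m (f : 'I_n -> 'I_m) (x : 'rV[R]_m) p :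
  evalp x (rename f p) = evalp (pullv f x) p.
Proof.
rewrite /evalp /rename [X in mmap _ _ X]/mmap raddf_sum [RHS]/mmap.
apply: eq_bigr => i _; rewrite /= rmorphM /= mmapC; congr (_ * _).
rewrite /mmap1 rmorph_prod; apply: eq_bigr => j _.
by rewrite rmorphXn /= mmapX mmap1U mxE.
Qed.

Lemma solves_rename R n m (f : 'I_n -> 'I_m) (x : 'rV[R]_m) s :
  solves [seq rename f p | p <- s] x = solves s (pullv f x).
Proof.
rewrite /solves all_map; apply: eq_all => p /=.
by rewrite evalp_rename.
Qed.

Lemma pullv_ext R n m k (f : 'I_n -> 'I_m) (x : 'rV[R]_m) (y : 'rV[R]_k) :
  pullv (rename_ext f) (row_mx x y) = row_mx (pullv f x) y.
Proof.
apply/rowP => i; rewrite mxE /rename_ext [RHS]mxE.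
by case: (split i) => j; rewrite ?row_mxEl ?row_mxEr ?mxE.
Qed.

Lemma holds_rename R n m (f : 'I_n -> 'I_m) (phi : ppform n) (x : 'rV[R]_m) :
  holds (pprename f phi) x <-> holds phi (pullv f x).
Proof.
elim: phi => [k s|g IH|g IHg h IHh|g IHg h IHh] /=; last 3 first.
- by split=> hh /IH.
- by split=> -[/IHg ? /IHh].
- by split=> -[/IHg|/IHh]; by [left|right].
by split=> -[y hy]; exists y; rewrite ?solves_rename pullv_ext // in hy *;
   rewrite solves_rename pullv_ext in hy.
Qed.

Definition pp_schemic n (s : schemic n) : ppform n :=
  PPex (k := 0) [seq rename (lshift 0) p | p <- s].

Lemma holds_schemic R n (s : schemic n) (x : 'rV[R]_n) :
  holds (pp_schemic s) x <-> solves s x.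
Proof.
rewrite /=; split=> [[y]|hx].
  rewrite solves_rename; suff -> : pullv (lshift 0) (row_mx x y) = x by [].
  by apply/rowP=> i; rewrite mxE row_mxEl.
exists 0; rewrite solves_rename.
suff -> : pullv (lshift 0) (row_mx x (0 : 'rV_0)) = x by [].
by apply/rowP=> i; rewrite mxE row_mxEl.
Qed.

Lemma form1_subproof n (phi : ppform n) R :
  exists2 f, f = phi & forall x : 'rV[R]_n, holds f x <-> points (eq^~ phi) x.
Proof. by exists phi => // x; split=> [h|[_ -> //]]; exists phi. Qed.

Definition form1 n (phi : ppform n) : formulary n :=
  Formulary (form1_subproof phi).

Section Pairs.
Variables (n m k : nat) (op : ppform n -> ppform m -> ppform k).
Variables (cond : Prop -> Prop -> Prop).
Variables (pl : forall R, 'rV[R]_k -> 'rV[R]_n).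
Variables (pr : forall R, 'rV[R]_k -> 'rV[R]_m).
Hypothesis condS : forall P P' Q Q' : Prop,
  (P -> P') -> (Q -> Q') -> cond P Q -> cond P' Q'.
Hypothesis opP : forall R f g (x : 'rV[R]_k),
  holds (op f g) x <-> cond (holds f (pl x)) (holds g (pr x)).
Variables (Phi : formulary n) (Psi : formulary m).

Definition pairs (h : ppform k) : Prop :=
  exists f g, [/\ Phi f, Psi g & h = op f g].

Lemma points_pairs R (x : 'rV[R]_k) :
  points pairs x <-> cond (points Phi (pl x)) (points Psi (pr x)).
Proof.
split=> [[h [f [g [hf hg ->]]]] /opP|].
  by apply: condS => ?; [exists f|exists g].
have [f hf fP] := formularyP Phi R; have [g hg gP] := formularyP Psi R.
move=> h; exists (op f g); first by exists f, g.
by apply/opP; apply: condS h => [/fP|/gP].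
Qed.

Lemma pairs_subproof R : exists2 h, pairs h &
  forall x : 'rV[R]_k, holds h x <-> points pairs x.
Proof.
have [f hf fP] := formularyP Phi R; have [g hg gP] := formularyP Psi R.
exists (op f g); first by exists f, g.
move=> x; split=> [h|/points_pairs h].
  by exists (op f g) => //; exists f, g.
by apply/opP; apply: condS h => [/fP|/gP].
Qed.

Definition pairs_formulary : formulary k := Formulary pairs_subproof.
End Pairs.

Section FormularyOps.

Let and_mono (P P' Q Q' : Prop) : (P -> P') -> (Q -> Q') -> P /\ Q -> P' /\ Q'.
Proof. by move=> hP hQ [/hP ? /hQ]. Qed.
Let or_mono (P P' Q Q' : Prop) : (P -> P') -> (Q -> Q') -> P \/ Q -> P' \/ Q'.
Proof. by move=> hP hQ [/hP|/hQ]; [left|right]. Qed.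

Definition pprod n m (f : ppform n) (g : ppform m) : ppform (n + m) :=
  PPand (pprename (lshift m) f) (pprename (@rshift n m) g).

Lemma pprodP R n m (f : ppform n) (g : ppform m) (x : 'rV[R]_(n + m)) :
  holds (pprod f g) x <-> holds f (pullv (lshift m) x) /\
                          holds g (pullv (@rshift n m) x).
Proof. by rewrite /=; split=> -[/holds_rename ? /holds_rename]. Qed.

(* {phi /\ psi}, {phi \/ psi} and {phi(x) /\ psi(y)}, for phi in Phi and psi
   in Psi.  The set {phi \/ psi} has the same points as the union of Phi and
   Psi, but unlike the latter it always is a formulary. *)
Definition formM n (Phi Psi : formulary n) : formulary n :=
  pairs_formulary and_mono
    (fun R f g (x : 'rV[R]_n) => iff_refl (holds (PPand f g) x)) Phi Psi.

Definition formU n (Phi Psi : formulary n) : formulary n :=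
  pairs_formulary or_mono
    (fun R f g (x : 'rV[R]_n) => iff_refl (holds (PPor f g) x)) Phi Psi.

Definition formX n m (Phi : formulary n) (Psi : formulary m) :
    formulary (n + m) :=
  pairs_formulary and_mono (fun R => @pprodP R n m) Phi Psi.

Lemma points_formM R n (Phi Psi : formulary n) (x : 'rV[R]_n) :
  points (formM Phi Psi) x <-> points Phi x /\ points Psi x.
Proof.
exact: (@points_pairs _ _ _ (@PPand n) and (fun _ => id) (fun _ => id)).
Qed.

Lemma points_formU R n (Phi Psi : formulary n) (x : 'rV[R]_n) :
  points (formU Phi Psi) x <-> points Phi x \/ points Psi x.
Proof.
exact: (@points_pairs _ _ _ (@PPor n) or (fun _ => id) (fun _ => id)).
Qed.

Lemma points_formX R n m (Phi : formulary n) (Psi : formulary m)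
    (x : 'rV[R]_(n + m)) :
  points (formX Phi Psi) x <-> points Phi (pullv (lshift m) x) /\
                               points Psi (pullv (@rshift n m) x).
Proof.
exact: (@points_pairs _ _ _ (@pprod n m) and
  (fun R => @pullv R _ _ (lshift m)) (fun R => @pullv R _ _ (@rshift n m))
  and_mono (fun R => @pprodP R n m)).
Qed.

End FormularyOps.

(* For every R, theta (resp. theta') restricted to Phi(R) (resp. Psi(R)) is
   the graph of the bijection f : Phi(R) -> Psi(R) (resp. of its inverse). *)
Definition schemic_iso n m (Phi : formulary n) (Psi : formulary m) : Prop :=
  exists (theta : schemic (n + m)) (theta' : schemic (m + n)), forall R,
  exists (f : 'rV[R]_n -> 'rV[R]_m) (g : 'rV[R]_m -> 'rV[R]_n),
  [/\ forall x, points Phi x -> points Psi (f x) /\ g (f x) = x,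
      forall y, points Psi y -> points Phi (g y) /\ f (g y) = y,
      forall x y, points Phi x -> solves theta (row_mx x y) <-> y = f x &
      forall y x, points Psi y -> solves theta' (row_mx y x) <-> x = g y].

Lemma solves_cat R n (s t : schemic n) (x : 'rV[R]_n) :
  solves (s ++ t) x = solves s x && solves t x.
Proof. exact: all_cat. Qed.

Definition graph_eqs n m (f : 'I_m -> 'I_n) : schemic (n + m) :=
  [seq 'X_(rshift n j) - 'X_(lshift m (f j)) | j <- enum 'I_m].

Lemma evalpB R n (x : 'rV[R]_n) p q : evalp x (p - q) = evalp x p - evalp x q.
Proof. by rewrite /evalp /= raddfB. Qed.
Lemma evalpD R n (x : 'rV[R]_n) p q : evalp x (p + q) = evalp x p + evalp x q.
Proof. by rewrite /evalp /= raddfD. Qed.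
Lemma evalpM R n (x : 'rV[R]_n) p q : evalp x (p * q) = evalp x p * evalp x q.
Proof. by rewrite /evalp /= rmorphM. Qed.
Lemma evalp0 R n (x : 'rV[R]_n) : evalp x 0 = 0.
Proof. by rewrite /evalp /= raddf0. Qed.
Lemma evalp1 R n (x : 'rV[R]_n) : evalp x 1 = 1.
Proof. by rewrite /evalp /= rmorph1. Qed.
Lemma evalpX R n (x : 'rV[R]_n) i : evalp x 'X_i = x 0 i.
Proof. by rewrite /evalp mmapX mmap1U. Qed.

Lemma solves_graph R n m (f : 'I_m -> 'I_n) (x : 'rV[R]_n) (y : 'rV[R]_m) :
  solves (graph_eqs f) (row_mx x y) <-> y = pullv f x.
Proof.
rewrite /solves all_map; split=> [/allP h|-> ].
  apply/rowP => j; have /= := h j (mem_enum _ j).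
  by rewrite evalpB !evalpX row_mxEl row_mxEr mxE subr_eq0 => /eqP.
by apply/allP => j _ /=; rewrite evalpB !evalpX row_mxEl row_mxEr mxE subrr.
Qed.

Lemma schemic_iso_reindex n m (Phi : formulary n) (Psi : formulary m)
    (f : 'I_m -> 'I_n) (g : 'I_n -> 'I_m) : cancel f g -> cancel g f ->
  (forall R (x : 'rV[R]_n), points Phi x <-> points Psi (pullv f x)) ->
  schemic_iso Phi Psi.
Proof.
move=> fg gf PhiPsi; exists (graph_eqs f), (graph_eqs g) => R.
have fK (x : 'rV[R]_n) : pullv g (pullv f x) = x.
  by apply/rowP => i; rewrite !mxE gf.
have gK (x : 'rV[R]_m) : pullv f (pullv g x) = x.
  by apply/rowP => i; rewrite !mxE fg.
exists (pullv f), (pullv g); split=> [x /PhiPsi //|y hy|x y _|y x _].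
- by split=> //; apply/PhiPsi; rewrite gK.
- exact: solves_graph.
- exact: solves_graph.
Qed.

Definition equivalent n (Phi Psi : formulary n) : Prop :=
  forall R (x : 'rV[R]_n), points Phi x <-> points Psi x.

Lemma equivalent_iso n (Phi Psi : formulary n) :
  equivalent Phi Psi -> schemic_iso Phi Psi.
Proof.
move=> h; apply: (@schemic_iso_reindex _ _ _ _ id id) => // R x.
suff -> : pullv id x = x by [].
by apply/rowP => i; rewrite mxE.
Qed.

Lemma schemic_iso_sym n m (Phi : formulary n) (Psi : formulary m) :
  schemic_iso Phi Psi -> schemic_iso Psi Phi.
Proof.
case=> t [t' h]; exists t', t => R.
by have [f [g [h1 h2 h3 h4]]] := h R; exists g, f.
Qed.

Definition swap_ord n m (i : 'I_(n + m)) : 'I_(m + n) :=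
  match split i with inl j => rshift m j | inr j => lshift n j end.

Lemma splitL n m (i : 'I_n) : split (lshift m i) = inl i.
Proof.
case: splitP => j //= h; first by congr inl; apply/val_inj.
by have := ltn_ord i; rewrite h ltnNge leq_addr.
Qed.

Lemma splitR n m (i : 'I_m) : split (rshift n i) = inr i.
Proof.
case: splitP => j //= h; last by congr inr; apply/val_inj/(@addnI n).
by have := ltn_ord j; rewrite -h ltnNge leq_addr.
Qed.

Lemma swap_ordK n m : cancel (@swap_ord n m) (@swap_ord m n).
Proof.
move=> i; rewrite -[RHS]splitK /swap_ord.
by case: (split i) => j; rewrite ?splitL ?splitR.
Qed.

Lemma formX_isoC n m (Phi : formulary n) (Psi : formulary m) :
  schemic_iso (formX Phi Psi) (formX Psi Phi).
Proof.
apply: (schemic_iso_reindex (@swap_ordK m n) (@swap_ordK n m)) => R x.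
have hl : pullv (lshift n) (pullv (@swap_ord m n) x) = pullv (@rshift n m) x.
  by apply/rowP => i; rewrite !mxE /swap_ord splitL.
have hr : pullv (@rshift m n) (pullv (@swap_ord m n) x) = pullv (lshift m) x.
  by apply/rowP => i; rewrite !mxE /swap_ord splitR.
split=> /points_formX[h1 h2]; apply/points_formX; first by rewrite hl hr.
by rewrite hl hr in h1 h2.
Qed.

Lemma pullv_comp R n m k (f : 'I_n -> 'I_m) (g : 'I_m -> 'I_k)
  (x : 'rV[R]_k) : pullv f (pullv g x) = pullv (g \o f) x.
Proof. by apply/rowP => i; rewrite !mxE. Qed.

Lemma eq_pullv R n m (f g : 'I_n -> 'I_m) (x : 'rV[R]_m) :
  f =1 g -> pullv f x = pullv g x.
Proof. by move=> fg; apply/rowP => i; rewrite !mxE fg. Qed.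

Lemma formX_isoA n m k (Phi : formulary n) (Psi : formulary m)
    (Theta : formulary k) :
  schemic_iso (formX Phi (formX Psi Theta)) (formX (formX Phi Psi) Theta).
Proof.
have e := addnA n m k.
apply: (@schemic_iso_reindex _ _ _ _ (cast_ord (esym e)) (cast_ord e)).
- exact: cast_ordKV.
- exact: cast_ordK.
move=> R x.
have h1 : pullv (lshift m) (pullv (lshift k) (pullv (cast_ord (esym e)) x)) =
          pullv (lshift (m + k)) x.
  by rewrite !pullv_comp; apply: eq_pullv => i; apply: val_inj.
have h2 : pullv (@rshift n m) (pullv (lshift k) (pullv (cast_ord (esym e)) x))
          = pullv (lshift k) (pullv (@rshift n (m + k)) x).
  by rewrite !pullv_comp; apply: eq_pullv => i; apply: val_inj.
have h3 : pullv (@rshift (n + m) k) (pullv (cast_ord (esym e)) x) =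
          pullv (@rshift m k) (pullv (@rshift n (m + k)) x).
  by rewrite !pullv_comp; apply: eq_pullv => i; apply: val_inj => /=; rewrite addnA.
split.
  case/points_formX => a /points_formX[b c].
  by apply/points_formX; split; [apply/points_formX|]; rewrite ?h1 ?h2 ?h3.
case/points_formX => /points_formX[a b] c; rewrite ?h1 ?h2 ?h3 in a b c.
by apply/points_formX; split=> //; apply/points_formX.
Qed.

Definition scheme_form n (s : schemic n) : formulary n := form1 (pp_schemic s).

Lemma points_scheme R n (s : schemic n) (x : 'rV[R]_n) :
  points (scheme_form s) x <-> solves s x.
Proof.
by split=> [[_ -> /holds_schemic]|/holds_schemic h] //; exists (pp_schemic s).
Qed.

Lemma formX_iso1 n (Phi : formulary n) :
  schemic_iso (formX (scheme_form [::] : formulary 0) Phi) Phi.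
Proof.
apply: schemic_iso_sym.
apply: (@schemic_iso_reindex _ _ _ _ (id : 'I_(0 + n) -> 'I_n) id) => // R x.
have h : pullv (@rshift 0 n) (pullv (id : 'I_(0 + n) -> 'I_n) x) = x.
  by apply/rowP => i; rewrite !mxE; congr (x 0 _); apply: val_inj.
split=> [hx|/points_formX[_]]; last by rewrite h.
by apply/points_formX; split; [apply/points_scheme|rewrite h].
Qed.

Lemma formX_isoL n m k (Phi : formulary n) (Phi' : formulary m)
    (Psi : formulary k) :
  schemic_iso Phi Phi' -> schemic_iso (formX Phi Psi) (formX Phi' Psi).
Proof.
pose u a b := lshift (b + k) \o (lshift k : 'I_a -> 'I_(a + k)).
pose v a b := (@rshift (a + k) (b + k)) \o (lshift k : 'I_b -> _).
pose w a b (i : 'I_(a + b)) : 'I_((a + k) + (b + k)) :=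
  match split i with inl j => u a b j | inr j => v a b j end.
pose T a b (t : schemic (a + b)) : schemic ((a + k) + (b + k)) :=
  [seq rename (@w a b) p | p <- t] ++
  [seq 'X_(rshift (a + k) (rshift b j)) - 'X_(lshift (b + k) (rshift a j))
     | j <- enum 'I_k].
have TP R a b (t : schemic (a + b)) (x : 'rV[R]_(a + k)) (y : 'rV[R]_(b + k)) :
    solves (T a b t) (row_mx x y) <->
    solves t (row_mx (pullv (lshift k) x) (pullv (lshift k) y)) /\
    pullv (@rshift b k) y = pullv (@rshift a k) x.
  rewrite solves_cat solves_rename.
  have -> : pullv (@w a b) (row_mx x y) =
            row_mx (pullv (lshift k) x) (pullv (lshift k) y).
    apply/rowP => i; rewrite mxE [RHS]mxE /w.
    by case: (split i) => j; rewrite /u /v /= ?row_mxEl ?row_mxEr mxE.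
  rewrite [X in _ && X]all_map; split=> [/andP[-> /allP h]|[-> h]].
    split=> //; apply/rowP => j; have /= := h j (mem_enum _ j).
    by rewrite evalpB !evalpX row_mxEl row_mxEr !mxE subr_eq0 => /eqP.
  apply/allP => j _ /=; rewrite evalpB !evalpX row_mxEl row_mxEr.
  by move/rowP: h => /(_ j); rewrite !mxE => ->; rewrite subrr.
have split_eq (R : artAlg F) a (y z : 'rV[R]_(a + k)) :
    pullv (lshift k) y = pullv (lshift k) z ->
    pullv (@rshift a k) y = pullv (@rshift a k) z -> y = z.
  move=> /rowP hl /rowP hr; apply/rowP => i; rewrite -[i]splitK.
  by case: (split i) => j; [have := hl j|have := hr j]; rewrite !mxE.
case=> t [t' h]; exists (T n m t), (T m n t') => R.
have [f [g [fP gP tP t'P]]] := h R.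
pose lift a b (f : 'rV[R]_a -> 'rV[R]_b) (x : 'rV[R]_(a + k)) :=
  row_mx (f (pullv (lshift k) x)) (pullv (@rshift a k) x).
have liftl a b (e : 'rV[R]_a -> 'rV[R]_b) x :
    pullv (lshift k) (lift a b e x) = e (pullv (lshift k) x).
  by apply/rowP => i; rewrite mxE row_mxEl.
have liftr a b (e : 'rV[R]_a -> 'rV[R]_b) x :
    pullv (@rshift b k) (lift a b e x) = pullv (@rshift a k) x.
  by apply/rowP => i; rewrite mxE row_mxEr.
exists (lift n m f), (lift m n g); split.
- move=> x /points_formX[hx hy]; have [fx gfx] := fP _ hx; split.
    by apply/points_formX; rewrite liftl liftr.
  by apply: split_eq; rewrite ?liftl ?liftr // gfx.
- move=> x /points_formX[hx hy]; have [fx gfx] := gP _ hx; split.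
    by apply/points_formX; rewrite liftl liftr.
  by apply: split_eq; rewrite ?liftl ?liftr // gfx.
- move=> x y /points_formX[hx hy]; split=> [/TP[/(tP _ _ hx) h1 h2]|->].
    by apply: split_eq; rewrite ?liftl ?liftr.
  by apply/TP; rewrite liftl liftr; split=> //; apply/(tP _ _ hx).
- move=> x y /points_formX[hx hy]; split=> [/TP[/(t'P _ _ hx) h1 h2]|->].
    by apply: split_eq; rewrite ?liftl ?liftr.
  by apply/TP; rewrite liftl liftr; split=> //; apply/(t'P _ _ hx).
Qed.

Definition anyForm : choiceType := {n : nat & formulary n}.
Definition mkForm n (Phi : formulary n) : anyForm := Tagged formulary Phi.

(* Equivalent formularies are not identified beforehand: as they are
   isomorphic, the first family of relations identifies them. *)
Inductive gr_rel : {freeg anyForm} -> Prop :=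
| gr_iso n m (Phi : formulary n) (Psi : formulary m) :
    schemic_iso Phi Psi -> gr_rel (<< mkForm Phi >> - << mkForm Psi >>)
| gr_scissor n (Phi Psi : formulary n) :
    gr_rel (<< mkForm (formU Phi Psi) >> + << mkForm (formM Phi Psi) >>
            - << mkForm Phi >> - << mkForm Psi >>).

Definition mul_anyForm (x y : anyForm) : anyForm :=
  mkForm (formX (tagged x) (tagged y)).

Definition freeg_mul (x y : {freeg anyForm}) : {freeg anyForm} :=
  fglift (fun a => fglift (fun b => << mul_anyForm a b >>) y) x.

Let N := zspan gr_rel.
Let E x y := N (x - y).

Lemma freeg_elim (P : {freeg anyForm} -> Prop) :
  P 0 -> (forall x y, P x -> P y -> P (x - y)) -> (forall a, P << a >>) ->
  forall x, P x.
Proof.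
move=> P0 PB PU x; rewrite -(freeg_sumE x).
have PN y : P y -> P (- y) by move=> hy; rewrite -(sub0r y); apply: PB.
have PD y z : P y -> P z -> P (y + z).
  by move=> hy hz; rewrite -(opprK z); apply/PB/PN.
elim/big_ind: _ => // a _; rewrite -[coeff a x]intz -freegU_mulz.
case: (coeff a x) => k; last rewrite NegzE mulrNz; last apply: PN;
  rewrite -pmulrn; elim: (k in P (_ *+ k)) => [|j IH];
  rewrite ?mulr0n // mulrS; exact: PD.
Qed.

Lemma freeg_mulUU a b : freeg_mul << a >> << b >> = << mul_anyForm a b >>.
Proof. by rewrite /freeg_mul !liftU !scale1r. Qed.

Lemma freeg_mulBl x y z : freeg_mul (x - y) z = freeg_mul x z - freeg_mul y z.
Proof. exact: lift_is_additive. Qed.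

Lemma freeg_mul0l z : freeg_mul 0 z = 0.
Proof. by have := freeg_mulBl 0 0 z; rewrite !subrr. Qed.

Lemma freeg_mulBr z x y : freeg_mul z (x - y) = freeg_mul z x - freeg_mul z y.
Proof.
elim/freeg_elim: z => [|z t hz ht|a]; first by rewrite !freeg_mul0l subr0.
  by rewrite !freeg_mulBl hz ht opprD addrACA -!opprD.
by rewrite /freeg_mul !liftU !scale1r; apply: lift_is_additive.
Qed.

Lemma freeg_mul0r z : freeg_mul z 0 = 0.
Proof. by have := freeg_mulBr z 0 0; rewrite !subrr. Qed.

Lemma freeg_mulDl x y z : freeg_mul (x + y) z = freeg_mul x z + freeg_mul y z.
Proof.
by rewrite -{1}(opprK y) freeg_mulBl -(sub0r y) freeg_mulBl freeg_mul0l sub0r opprK.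
Qed.

Lemma gr_eq x y : x = y -> E x y.
Proof. by move=> ->; rewrite /E subrr; apply: zspan0. Qed.
Lemma gr_sym x y : E x y -> E y x.
Proof. exact: zspanC. Qed.
Lemma gr_trans y x z : E x y -> E y z -> E x z.
Proof.
move=> xy yz; have -> : E x z = N ((x - y) + (y - z)) by rewrite /E subrKA.
exact: zspanD.
Qed.
Lemma gr_N x x' : E x x' -> E (- x) (- x').
Proof. by move=> /zspanN; rewrite /E opprD. Qed.
Lemma gr_D x x' y y' : E x x' -> E y y' -> E (x + y) (x' + y').
Proof. by move=> hx hy; rewrite /E opprD addrACA; apply: zspanD. Qed.
Lemma gr_B x x' y y' : E x x' -> E y y' -> E (x - y) (x' - y').
Proof. by move=> hx hy; apply/gr_D/gr_N. Qed.
Lemma gr_isoE n m (Phi : formulary n) (Psi : formulary m) :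
  schemic_iso Phi Psi -> E << mkForm Phi >> << mkForm Psi >>.
Proof. by move=> h; apply/zspan_gen/gr_iso. Qed.

Lemma gr_mulC x y : E (freeg_mul x y) (freeg_mul y x).
Proof.
elim/freeg_elim: x => [|x t hx ht|[n a]].
- by rewrite freeg_mul0l freeg_mul0r; apply: gr_eq.
- by rewrite freeg_mulBl freeg_mulBr; apply: gr_B.
elim/freeg_elim: y => [|x t hx ht|[m b]].
- by rewrite freeg_mul0l freeg_mul0r; apply: gr_eq.
- by rewrite freeg_mulBl freeg_mulBr; apply: gr_B.
rewrite !freeg_mulUU; apply: gr_isoE; exact: formX_isoC.
Qed.

Lemma gr_mulA x y z :
  E (freeg_mul x (freeg_mul y z)) (freeg_mul (freeg_mul x y) z).
Proof.
elim/freeg_elim: x => [|x t hx ht|[n a]].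
- by rewrite !freeg_mul0l; apply: gr_eq.
- by rewrite !freeg_mulBl; apply: gr_B.
elim/freeg_elim: y => [|x t hx ht|[m b]].
- by rewrite freeg_mul0r !freeg_mul0l freeg_mul0r; apply: gr_eq.
- by rewrite freeg_mulBr !freeg_mulBl freeg_mulBr; apply: gr_B.
elim/freeg_elim: z => [|x t hx ht|[k c]].
- by rewrite !freeg_mul0r; apply: gr_eq.
- by rewrite !freeg_mulBr; apply: gr_B.
rewrite !freeg_mulUU; apply: gr_isoE; exact: formX_isoA.
Qed.

Definition freeg_one : {freeg anyForm} :=
  << mkForm (scheme_form [::] : formulary 0) >>.

Lemma gr_mul1 x : E (freeg_mul freeg_one x) x.
Proof.
elim/freeg_elim: x => [|x t hx ht|[n a]].
- by rewrite freeg_mul0r; apply: gr_eq.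
- by rewrite freeg_mulBr; apply: gr_B.
rewrite freeg_mulUU; apply: gr_isoE; exact: formX_iso1.
Qed.

Lemma gr_mulNl x y : N x -> N (freeg_mul x y).
Proof.
move=> Nx; elim/freeg_elim: y => [|s t hx ht|[k c]].
- by rewrite freeg_mul0r; apply: zspan0.
- by rewrite freeg_mulBr; apply: zspanB.
elim: Nx => [_ [n m Phi Psi h|n Phi Psi]||s t _ hs _ ht].
- rewrite freeg_mulBl !freeg_mulUU; apply: gr_isoE; exact: formX_isoL.
- rewrite !freeg_mulBl freeg_mulDl !freeg_mulUU /mul_anyForm /=.
  set U := << _ >>; set M := << _ >>; set A := << _ >>; set B := << _ >>.
  have hU : E U << mkForm (formU (formX Phi c) (formX Psi c)) >>.
    apply/gr_isoE/equivalent_iso => R v; split.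
      by case/points_formX => /points_formU[] h1 h2; apply/points_formU;
        [left|right]; apply/points_formX.
    by case/points_formU => /points_formX[h1 h2]; apply/points_formX;
      split=> //; apply/points_formU; [left|right].
  have hM : E M << mkForm (formM (formX Phi c) (formX Psi c)) >>.
    apply/gr_isoE/equivalent_iso => R v; split.
      by case/points_formX => /points_formM[h1 h3] h2; apply/points_formM;
        split; apply/points_formX.
    by case/points_formM => /points_formX[h1 h2] /points_formX[h3 _];
      apply/points_formX; split=> //; apply/points_formM.
  have h : N (<< mkForm (formU (formX Phi c) (formX Psi c)) >> +
              << mkForm (formM (formX Phi c) (formX Psi c)) >> - A - B).
    exact/zspan_gen/gr_scissor.
  rewrite -addrA -opprD; apply: (gr_trans (gr_D hU hM)).
  by rewrite /E opprD addrA.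
- by rewrite freeg_mul0l; apply: zspan0.
- by rewrite freeg_mulBl; apply: zspanB.
Qed.

Lemma gr_M x x' y y' : E x x' -> E y y' -> E (freeg_mul x y) (freeg_mul x' y').
Proof.
move=> hx hy; apply: (@gr_trans (freeg_mul x' y)).
  by rewrite /E -freeg_mulBl; apply: gr_mulNl.
apply: gr_trans (gr_mulC _ _) (gr_trans _ (gr_mulC _ _)).
by rewrite /E -freeg_mulBl; apply: gr_mulNl.
Qed.

Definition Grinf_pre : preRing :=
  @PreRing {freeg anyForm} E 0 -%R +%R freeg_one freeg_mul
   (fun x => gr_eq erefl) gr_sym gr_trans gr_N gr_D gr_M
   (fun x y z => gr_eq (addrA x y z)) (fun x y => gr_eq (addrC x y))
   (fun x => gr_eq (add0r x)) (fun x => gr_eq (addNr x))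
   gr_mulA gr_mulC gr_mul1 (fun x y z => gr_eq (freeg_mulDl x y z)).

(* Gr^oo(F^pp) *)
Definition Grinf : comPzRingType := quotRing Grinf_pre.
Definition class_inf n (Phi : formulary n) : Grinf :=
  @qr_pi Grinf_pre << mkForm Phi >>.

Definition ideal_of n (s : schemic n) : {mpoly F[n]} -> Prop :=
  ideal_span (fun p => p \in s).

(* The k-fold products of elements of w: generators of the k-th power of the
   ideal generated by w. *)
Definition power_gens n k (w : schemic n) : schemic n :=
  iter k (fun g => [seq p * q | p <- w, q <- g]) [:: 1].

(* V = Spec F[x]/(v), and Y is the closed subscheme defined in V by the ideal
   I = (w) + (v) / (v); the preimage of I ^ k in F[x] is (v) + (w) ^ k. *)
Definition jet_forms n (v w : schemic n) (phi : ppform n) : Prop :=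
  exists k (s : schemic n), [/\ (0 < k)%N,
    forall p, ideal_of s p <-> ideal_of (v ++ power_gens k w) p &
    phi = pp_schemic s].

Lemma ideal_vanish R n (s : schemic n) (x : 'rV[R]_n) p :
  solves s x -> ideal_of s p -> evalp x p = 0.
Proof.
move=> /allP hs; elim=> [q /hs /eqP //||q r _ hq _ hr|a q _ hq].
- exact: evalp0.
- by rewrite evalpD hq hr addr0.
- by rewrite evalpM hq mulr0.
Qed.

Lemma solves_ideal R n (s t : schemic n) (x : 'rV[R]_n) :
  (forall p, ideal_of s p -> ideal_of t p) -> solves t x -> solves s x.
Proof.
move=> st ht; apply/allP => p ps; apply/eqP/(ideal_vanish ht)/st.
exact: ideal_gen.
Qed.

Lemma art_nilpotent R : exists d, forall r : R,
  (exists k, r ^+ k = 0) -> r ^+ d = 0.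
Proof.
have [d [b bP]] := art_finite R; exists d => r [k rk].
pose c (i : nat) := sval (cid (bP (r ^+ i))).
have cP i : r ^+ i = \sum_j c i j *: b j := svalP (cid (bP (r ^+ i))).
pose M : 'M[F]_(d.+1, d) := \matrix_(i, j) c i j.
have /rowV0Pn[u /sub_kermxP uM u0] : kermx M != 0.
  by rewrite -mxrank_eq0 mxrank_ker -lt0n subn_gt0 ltnS rank_leq_col.
have ur : \sum_(i < d.+1) u 0 i *: r ^+ i = 0.
  under eq_bigr => i _ do rewrite cP scaler_sumr.
  rewrite exchange_big /= big1 // => j _.
  under eq_bigr => i _ do rewrite scalerA.
  rewrite -scaler_suml; suff -> : \sum_i u 0 i * c i j = 0 by rewrite scale0r.
  have /rowP/(_ j) := uM; rewrite mxE [RHS]mxE => uj; rewrite -[RHS]uj.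
  by apply: eq_bigr => i _; rewrite mxE.
have /rV0Pn[i ui] := u0.
pose i0 := [arg min_(l < i | u 0%R l != 0%R) (l : nat)]%N.
have [h1 h2] : u 0 i0 != 0 /\ forall j, u 0 j != 0 -> (i0 <= j)%N.
  by rewrite /i0; case: arg_minnP.
pose q := \sum_(j < d.+1 | (i0 < j)%N) u 0 j *: r ^+ (j - i0.+1).
have e1 : u 0 i0 *: r ^+ i0 = - (r * q * r ^+ i0).
  apply/eqP; rewrite -addr_eq0 -ur (bigD1 i0) //=; apply/eqP; congr (_ + _).
  rewrite [RHS](bigID (fun j : 'I_d.+1 => (i0 < j)%N)) /= [X in _ = _ + X]big1.
    rewrite addr0 mulr_sumr mulr_suml; apply: eq_big => [j|j hj].
      by rewrite andbC -val_eqE /=; case: ltngtP.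
    rewrite -scalerAr -scalerAl -exprS -exprD; congr (_ *: _ ^+ _).
    by rewrite -subSn // subSS subnK // ltnW.
  move=> j /andP[ji hj]; have [->|/h2] := eqVneq (u 0 j) 0.
    by rewrite scale0r.
  by rewrite leq_eqVlt (negbTE hj) orbF => /eqP/val_inj e; rewrite e eqxx in ji.
pose q' := - (u 0 i0)^-1 *: q.
have e2 : r ^+ i0 = r * q' * r ^+ i0.
  rewrite -[LHS]scale1r -(mulVf h1) -scalerA e1.
  by rewrite /q' -scalerAr -scalerAl scalerN scaleNr.
have e3 j : r ^+ i0 = (r * q') ^+ j * r ^+ i0.
  by elim: j => [|j IH]; rewrite ?mul1r // exprSr -mulrA -e2.
have e4 : r ^+ i0 = 0 by rewrite (e3 k) exprMn rk !mul0r.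
have i0d : (i0 <= d)%N by rewrite -ltnS.
by rewrite -(subnK i0d) exprD e4 mulr0.
Qed.

Lemma nilpotent_prod (R : comPzRingType) d (ys : seq R) :
  (forall y, y \in ys -> y ^+ d = 0) ->
  forall ts : seq R, {subset ts <= ys} -> (size ys * d < size ts)%N ->
  \prod_(t <- ts) t = 0.
Proof.
elim: ys => [|y ys IH] hys.
  by case=> [//|t ts] /(_ t); rewrite mem_head => /(_ isT).
have {}IH := IH (fun z hz => hys z (mem_behead (s := y :: ys) hz)).
have hy : y ^+ d = 0 by apply: hys; rewrite mem_head.
suff acc : forall ts us j, {subset us <= ys} -> {subset ts <= y :: ys} ->
    (size ys * d + d < size us + size ts + j)%N ->
    y ^+ j * \prod_(t <- us) t * \prod_(t <- ts) t = 0.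
  move=> ts hts hsz; have := acc ts [::] 0%N.
  rewrite big_nil !mul1r; apply=> //.
  by rewrite add0n addn0 [X in (X < _)%N]addnC -mulSn.
elim=> [|t ts IHts] us j hus hts hsz.
  have [dj|jd] := leqP d j.
    by rewrite -(subnK dj) exprD hy mulr0 !mul0r.
  rewrite IH ?mulr0 ?mul0r //.
  rewrite addn0 in hsz; rewrite -(ltn_add2r d); apply: (leq_trans hsz).
  by rewrite leq_add2l ltnW.
have hts' : {subset ts <= y :: ys} by move=> z hz; apply/hts/mem_behead.
have : t \in y :: ys by apply: hts; rewrite mem_head.
rewrite big_cons in_cons => /orP[/eqP ->|tys].
  rewrite mulrA -[_ * y]mulrAC -exprSr; apply: IHts => //.
  by move: hsz; rewrite /= !(addnS, addSn).
rewrite mulrA -[_ * t]mulrA [_ * t]mulrC -(big_cons _ _ t us xpredT id).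
apply: IHts => //; last by move: hsz; rewrite /= !(addnS, addSn).
by move=> z; rewrite in_cons => /orP[/eqP ->|/hus].
Qed.

Lemma power_gensP n k (w : schemic n) p : p \in power_gens k w ->
  exists ts, [/\ size ts = k, {subset ts <= w} & p = \prod_(t <- ts) t].
Proof.
elim: k p => [|k IH] p.
  by rewrite inE => /eqP ->; exists [::]; rewrite big_nil.
case/allpairsP => -[a b] /= [aw /IH[ts [sz hts ->]] ->].
exists (a :: ts); rewrite /= sz big_cons; split=> // z.
by rewrite in_cons => /orP[/eqP ->|/hts].
Qed.

Lemma power_gens_exp n k (w : schemic n) p :
  p \in w -> p ^+ k \in power_gens k w.
Proof.
move=> pw; elim: k => [|k IH]; first by rewrite inE.
by rewrite exprS; apply/allpairsP; exists (p, p ^+ k).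
Qed.

Lemma evalp_prod R n (x : 'rV[R]_n) ts :
  evalp x (\prod_(t <- ts) t) = \prod_(t <- map (evalp x) ts) t.
Proof.
by elim: ts => [|t ts IH]; rewrite ?big_nil ?evalp1 //= !big_cons evalpM IH.
Qed.

Lemma evalp_exp R n (x : 'rV[R]_n) p k : evalp x (p ^+ k) = evalp x p ^+ k.
Proof. by elim: k => [|k IH]; rewrite ?evalp1 // !exprS evalpM IH. Qed.

Lemma total_jet_subproof n (v w : schemic n) R :
  exists2 phi, jet_forms v w phi &
    forall x : 'rV[R]_n, holds phi x <-> points (jet_forms v w) x.
Proof.
have [d dP] := art_nilpotent R; pose K := (size w * d).+1.
have hK : jet_forms v w (pp_schemic (v ++ power_gens K w)).
  by exists K, (v ++ power_gens K w).
exists (pp_schemic (v ++ power_gens K w)) => // x; split=> [h|].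
  by exists (pp_schemic (v ++ power_gens K w)).
case=> _ [k [s [k0 hs ->]]] /holds_schemic sx; apply/holds_schemic.
have : solves (v ++ power_gens k w) x by apply: solves_ideal sx => p /hs.
rewrite !solves_cat => /andP[-> /allP hk] /=.
apply/allP => p /(@power_gensP _ K)[ts [sz hts ->]].
rewrite evalp_prod; apply/eqP.
apply: (@nilpotent_prod _ d (map (evalp x) w)).
- move=> _ /mapP[q qw ->]; apply: dP; exists k; rewrite -evalp_exp.
  exact/eqP/hk/power_gens_exp.
- by move=> _ /mapP[q /hts qw ->]; apply: map_f.
- by rewrite !size_map sz.
Qed.

Definition total_jet n (v w : schemic n) : formulary n :=
  Formulary (total_jet_subproof v w).

Inductive form_rel : Grinf -> Prop :=
| form_jet n (v w : schemic n) : (forall p, ideal_of v p -> ideal_of w p) ->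
    form_rel (class_inf (total_jet v w) - class_inf (scheme_form w)).

Definition Grform : comPzRingType := idealQuot form_rel.

Definition scheme_class n (s : schemic n) : Grform :=
  toIdealQuot form_rel (class_inf (scheme_form s)).

Definition lefschetz : Grform := scheme_class ([::] : schemic 1).

Definition GrformL : comPzRingType := localize lefschetz.

(* f(x_0 + x_1 xi + ... + x_(n-1) xi^(n-1)), as a polynomial in xi; the i-th
   coordinate of the m-tuple x_j is the variable of index [mxvec_index j i]. *)
Definition arc_poly n m (f : {mpoly F[m]}) : {poly {mpoly F[n * m]}} :=
  mmap (fun c => (c%:MP)%:P)
    (fun i => \sum_(j < n) 'X_(mxvec_index j i) *: 'X^j) f.

Definition linear_arc n m (s : schemic m) : schemic (n * m) :=
  [seq (arc_poly n f)`_l | f <- s, l <- iota 0 n].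

Definition igu_geom m (s : schemic m) (n : nat) : Grform :=
  scheme_class (linear_arc n s).

Definition power_poly m (r : 'I_m -> F) (a : 'I_m -> nat) : {mpoly F[m]} :=
  \sum_(i < m) r i *: 'X_i ^+ a i.

(* The F-points at which the hypersurface f = 0 is singular (Jacobian
   criterion; meant for algebraically closed F).  Isolated: the only one in
   some Zariski open neighbourhood g <> 0. *)
Definition singular_point m (f : {mpoly F[m]}) (x : 'I_m -> F) : Prop :=
  f.@[x] = 0 /\ forall i, (f^`M(i)).@[x] = 0.

Definition isolated_singularity m (f : {mpoly F[m]}) (x : 'I_m -> F) : Prop :=
  singular_point f x /\
  exists2 g : {mpoly F[m]}, g.@[x] != 0 &
    forall y, g.@[y] != 0 -> singular_point f y -> y =1 x.

End Formulae.

Section PowerSeries.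
Variable R : comPzRingType.

Definition ps_mul (f g : nat -> R) (n : nat) : R :=
  \sum_(i < n.+1) f i * g (n - i)%N.

(* 1 - c t ^ k *)
Definition ps_one_sub (c : R) (k : nat) (n : nat) : R :=
  (n == 0%N)%:R - c *+ (n == k).

Definition ps_poly (Q : seq R) (n : nat) : R := nth 0 Q n.

(* S = P / D in R[[t]], where the constant coefficient of D is 1. *)
Definition ps_quotient (P D S : nat -> R) : Prop :=
  D 0%N = 1 /\ ps_mul D S =1 P.

Lemma ps_quotient_unique P D S S' :
  ps_quotient P D S -> ps_quotient P D S' -> S =1 S'.
Proof.
case=> D0 h [_ h'] n; elim/ltn_ind: n => n IH.
have := h n; rewrite -h' /ps_mul !big_ord_recl /= !subn0 D0 !mul1r.
under eq_bigr => i _ do rewrite IH ?subSS ?ltn_subrL ?(leq_trans _ (ltn_ord i)) //.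
by move/addIr.
Qed.

End PowerSeries.

(* Main.v *)
Require Import Defs.
From mathcomp Require Import all_boot all_order all_algebra.
From mathcomp Require Import mpoly ring.
From mathcomp Require Import boolp.

(** Write I_n for the class of the arcs of length n on X and L for the class of
    the line.  It is enough that D_n = I_n - L^N * I_(n-e)
    satisfy D_(n+1) = L^(m-1) * D_n for all n >= e, because the coefficients
    of the product of the series with its denominator then vanish beyond index
    e (ps_quotient_rat).

    An arc is a tuple of truncated series x_1, ..., x_m.  Over a local Artinian
    ring, each coefficient x_(l, i) is a unit or nilpotent, and the jet
    relations allow one to replace nilpotent by zero without changing classes.
    Hence every closed scheme V and every function q satisfy
      [V] = [V, q unit] + [V, q = 0] - [empty]     (sclass_cut).
    The last term is there since the empty scheme has a possibly nonzero class;
    it absorbs the class of every formulary, in particular L.  This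
    relation is applied to the coefficients x_(l, i) with a_i * l < e, by
    increasing a_i * l.

    If all these coefficients are zero, then x_i = xi^(e / a_i) * y_i, the
    equation becomes xi^e times the same equation in the y_i, and counting free
    coefficients yields L^N * I_(n-e) (sclass_shift).

    Otherwise let x_(l, j) be the unit that was met first, so that l is the
    order of x_j and v = a_j * l < e.  If a_j is nonzero in F, the coefficient
    of xi^n in the equation is an affine function of x_(l + n - v, j), whose
    slope r_j * a_j * x_(l, j)^(a_j - 1) is a unit; raising n by one thus adds m
    coordinates and one equation that eliminates a variable, which multiplies
    the class by L^(m-1) (open_class_separable).  The division by L in this
    count is where the localization is used.  If a_j is zero in F, the stratum
    is empty: as the singularity is isolated, at most one exponent is divisible
    by the characteristic (inseparable_exponent_uniq), and testing x_(l, j)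
    after all the other coefficients with a_i * l' <= v leaves
    r_j * x_(l, j)^(a_j) alone at xi^v (open_class_inseparable). *)

Set Implicit Arguments.
Unset Strict Implicit.
Unset Printing Implicit Defensive.

Import GRing.Theory.
Local Open Scope ring_scope.

(** * Classes of formularies *)

Lemma toLocalizeM (R : comPzRingType) (s x y : R) :
  toLocalize s (x * y) = toLocalize s x * toLocalize s y.
Proof. by rewrite /toLocalize -(qr_piM (A := localize_pre s)). Qed.

Lemma toLocalizeD (R : comPzRingType) (s x y : R) :
  toLocalize s (x + y) = toLocalize s x + toLocalize s y.
Proof.
rewrite /toLocalize -(qr_piD (A := localize_pre s)); congr qr_pi.
by rewrite /= !expr0 !mulr1.
Qed.

Lemma toLocalize1 (R : comPzRingType) (s : R) : toLocalize s 1 = 1.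
Proof. by []. Qed.

Lemma toLocalize_unit (R : comPzRingType) (s : R) :
  exists u, u * toLocalize s s = 1.
Proof.
exists (@qr_pi (localize_pre s) (1, 1%N)).
rewrite /toLocalize -(qr_piM (A := localize_pre s)).
rewrite -(qr_pi1 (localize_pre s)); apply/qr_eqP.
by exists 0%N; rewrite /= !mulr1.
Qed.

Lemma toIdealQuotM (R : comPzRingType) (S : R -> Prop) x y :
  toIdealQuot S (x * y) = toIdealQuot S x * toIdealQuot S y.
Proof. by rewrite /toIdealQuot -(qr_piM (A := idealQuot_pre S)). Qed.

Lemma toIdealQuotD (R : comPzRingType) (S : R -> Prop) x y :
  toIdealQuot S (x + y) = toIdealQuot S x + toIdealQuot S y.
Proof. by rewrite /toIdealQuot -(qr_piD (A := idealQuot_pre S)). Qed.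

Section Classes.
Variable F : fieldType.
Implicit Type R : artAlg F.

Definition fclass n (Phi : formulary F n) : GrformL F :=
  toLocalize (lefschetz F) (toIdealQuot (@form_rel F) (class_inf Phi)).

Definition sclass n (s : schemic F n) : GrformL F := fclass (scheme_form s).

Definition Lef : GrformL F := toLocalize (lefschetz F) (lefschetz F).

Lemma Lef_mulI (x y : GrformL F) : Lef * x = Lef * y -> x = y.
Proof.
have [u uL] := toLocalize_unit (lefschetz F) => h.
by rewrite -(mul1r x) -(mul1r y) -uL -!mulrA -/Lef h.
Qed.

Lemma fclass_iso n m (Phi : formulary F n) (Psi : formulary F m) :
  schemic_iso Phi Psi -> fclass Phi = fclass Psi.
Proof.
move=> h; rewrite /fclass /class_inf; congr (toLocalize _ (toIdealQuot _ _)).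
exact/qr_eqP/gr_isoE.
Qed.

Lemma fclass_equiv n (Phi Psi : formulary F n) :
  equivalent Phi Psi -> fclass Phi = fclass Psi.
Proof. by move=> /equivalent_iso/fclass_iso. Qed.

Lemma fclass_scissor n (Phi Psi : formulary F n) :
  fclass (formU Phi Psi) + fclass (formM Phi Psi) = fclass Phi + fclass Psi.
Proof.
rewrite /fclass -!toLocalizeD -!toIdealQuotD.
congr (toLocalize _ (toIdealQuot _ _)); rewrite /class_inf.
rewrite -!(qr_piD (A := Grinf_pre F)); apply/qr_eqP; rewrite /=.
rewrite opprD addrA; exact/zspan_gen/gr_scissor.
Qed.

Lemma fclassX n m (Phi : formulary F n) (Psi : formulary F m) :
  fclass (formX Phi Psi) = fclass Phi * fclass Psi.
Proof.
rewrite /fclass -!toLocalizeM -!toIdealQuotM.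
congr (toLocalize _ (toIdealQuot _ _)); rewrite /class_inf.
rewrite -!(qr_piM (A := Grinf_pre F)); congr qr_pi.
by rewrite /= freeg_mulUU.
Qed.

Lemma fclass_jet n (v w : schemic F n) :
  (forall p, ideal_of v p -> ideal_of w p) ->
  fclass (total_jet v w) = sclass w.
Proof.
move=> vw; rewrite /sclass /fclass; congr toLocalize.
by rewrite /toIdealQuot; apply/qr_eqP/ideal_gen/form_jet.
Qed.

(** The main source of schemic isomorphisms below.  A projection along some
    coordinates has a schemic graph; so has its inverse, as soon as the fibres
    are cut out by a schemic formula s with exactly one solution, since the
    inverse is then described by s itself.  No explicit formula for the inverse
    is required, which matters when that inverse involves division by units. *)
Lemma schemic_iso_pullv n m (Phi : formulary F n) (Psi : formulary F m)
    (f : 'I_m -> 'I_n) (s : schemic F n) :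
  (forall R (x : 'rV[R]_n),
     points Phi x <-> solves s x /\ points Psi (pullv f x)) ->
  (forall R (y : 'rV[R]_m), points Psi y ->
     exists! x : 'rV[R]_n, solves s x /\ pullv f x = y) ->
  schemic_iso Phi Psi.
Proof.
move=> PhiP ex.
pose l := fun i : 'I_n => rshift m i.
pose theta' := [seq rename l p | p <- s] ++
  [seq 'X_(lshift n j) - 'X_(rshift m (f j)) | j <- enum 'I_m].
exists (graph_eqs F f), theta' => R.
have thP (y : 'rV[R]_m) (x : 'rV[R]_n) : 
    solves theta' (row_mx y x) <-> solves s x /\ pullv f x = y.
  rewrite solves_cat solves_rename.
  have -> : pullv l (row_mx y x) = x.
    by apply/rowP => i; rewrite mxE row_mxEr.
  rewrite [X in _ && X]all_map; split=> [/andP[-> /allP h]|[-> h]].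
    split=> //; apply/rowP => j; have /= := h j (mem_enum _ j).
    by rewrite evalpB !evalpX row_mxEl row_mxEr !mxE subr_eq0 => /eqP.
  apply/allP => j _ /=; rewrite evalpB !evalpX row_mxEl row_mxEr.
  by move/rowP: h => /(_ j); rewrite !mxE => ->; rewrite subrr.
pose g (y : 'rV[R]_m) : 'rV[R]_n :=
  if pselect (points Psi y) is left py then sval (cid (ex R y py)) else 0.
have gP y : points Psi y -> [/\ solves s (g y), pullv f (g y) = y &
    forall x, solves s x /\ pullv f x = y -> x = g y].
  rewrite /g; case: pselect => // py _.
  by case: cid => x /= [[h1 h2] xu]; split=> // z /xu ->.
exists (pullv f), g; split.
- move=> x /PhiP[sx px]; split=> //.
  by have [_ _ h] := gP _ px; rewrite -(h x).
- by move=> y py; have [h1 h2 _] := gP _ py; split=> //; apply/PhiP; rewrite h2.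
- by move=> x y _; apply: solves_graph.
- move=> y x py; have [h1 h2 h3] := gP _ py.
  by split=> [/thP/h3|->]; last apply/thP.
Qed.

(** By finite dimension x is annihilated by a nonzero polynomial q * 'X^k with
    q(0) <> 0.  If x is not a unit then q(x), which differs from the nonzero
    scalar q(0) by a multiple of x, is a unit by locality; so x ^+ k = 0. *)
Lemma art_unit_or_nilp R (x : R) : x \is a GRing.unit \/ exists k, x ^+ k = 0.
Proof.
have [|xN] := boolP (x \is a GRing.unit); [by left|right].
have [d [b bP]] := art_finite R.
pose c (i : nat) := sval (cid (bP (x ^+ i))).
have cP i : x ^+ i = \sum_j c i j *: b j := svalP (cid (bP (x ^+ i))).
pose M : 'M[F]_(d.+1, d) := \matrix_(i, j) c i j.
have /rowV0Pn[u /sub_kermxP uM u0] : kermx M != 0.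
  by rewrite -mxrank_eq0 mxrank_ker -lt0n subn_gt0 ltnS rank_leq_col.
have ux : \sum_(i < d.+1) u 0 i *: x ^+ i = 0.
  under eq_bigr => i _ do rewrite cP scaler_sumr.
  rewrite exchange_big /= big1 // => j _.
  under eq_bigr => i _ do rewrite scalerA.
  rewrite -scaler_suml; suff -> : \sum_i u 0 i * c i j = 0 by rewrite scale0r.
  have /rowP/(_ j) := uM; rewrite mxE [RHS]mxE => uj; rewrite -[RHS]uj.
  by apply: eq_bigr => i _; rewrite mxE.
pose P := rVpoly u.
have P0 : P != 0.
  apply: contraNneq u0 => P0; apply/eqP.
  by rewrite -(rVpolyK u) -/P P0 linear0.
have Px : horner_alg x P = 0.
  rewrite /P /rVpoly poly_def rmorph_sum -[RHS]ux; apply: eq_bigr => i _.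
  rewrite insubT //= => lti.
  by rewrite -mul_polyC rmorphM rmorphXn /= horner_algX horner_algC
     mulr_algl; congr (u _ _ *: _); apply: val_inj.
have [k [q q0 Pq]] := multiplicity_XsubC P 0.
rewrite P0 /= in q0.
exists k; move: Px; rewrite Pq subr0 rmorphM rmorphXn /= horner_algX.
have qu : horner_alg x q \is a GRing.unit.
  have /factor_theorem[h qh] : root (q - (q.[0])%:P) 0.
    by rewrite rootE hornerD hornerN hornerC subrr.
  have q0u : in_alg R q.[0] \is a GRing.unit.
    by apply: (rmorph_unit (in_alg R)); rewrite unitfE.
  apply: contraT => quN.
  have hxN : - (horner_alg x h * x) \isn't a GRing.unit.
    by rewrite unitrN unitrM (negbTE xN) andbF.
  have := art_local quN hxN.
  move/(congr1 (horner_alg x)): qh; rewrite subr0 rmorphB rmorphM /=.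
  rewrite horner_algX horner_algC => /eqP.
  by rewrite subr_eq addrC => /eqP ->; rewrite addrK q0u.
by move=> h; rewrite -[LHS](mulKr qu) h mulr0.
Qed.

Lemma points_jet R n (s : schemic F n) q (x : 'rV[R]_n) :
  points (total_jet s (q :: s)) x <->
  solves s x /\ exists k, evalp x q ^+ k = 0.
Proof.
split=> [[_ [k [t [k0 ht ->]]] /holds_schemic tx]|[sx [k qk]]].
  have : solves (s ++ power_gens k (q :: s)) x.
    by apply: solves_ideal tx => p /ht.
  rewrite solves_cat => /andP[sx /allP gx]; split=> //; exists k.
  by rewrite -evalp_exp; apply/eqP/gx/power_gens_exp/mem_head.
exists (pp_schemic (s ++ power_gens k.+1 (q :: s))).
  by exists k.+1, (s ++ power_gens k.+1 (q :: s)).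
apply/holds_schemic; rewrite solves_cat sx andTb.
apply/allP => p /power_gensP[ts [sz hts ->]]; rewrite evalp_prod.
rewrite big_map.
have [/all_pred1P ->|/allPn[t tts tq]] := boolP (all (pred1 q) ts).
  rewrite big_nseq sz; have -> j : iter j ( *%R (evalp x q)) 1 = evalp x q ^+ j.
    by elim: j => //= j ->; rewrite exprS.
  by rewrite exprS qk mulr0.
have ts_s : t \in s by have := hts _ tts; rewrite inE (negbTE (tq : t != q)).
rewrite (big_rem t) //=; move/allP: sx => /(_ _ ts_s)/eqP ->.
by rewrite mul0r.
Qed.

Definition unit_form n (q : {mpoly F[n]}) : formulary F n :=
  form1 (PPex (k := 1)
    [:: rename (lshift 1) q * 'X_(rshift n ord0) - 1]).

Lemma points_form1 R n (phi : ppform F n) (x : 'rV[R]_n) :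
  points (form1 phi) x <-> holds phi x.
Proof. by split=> [[_ -> //]|h]; exists phi. Qed.

Lemma points_unit R n (q : {mpoly F[n]}) (x : 'rV[R]_n) :
  points (unit_form q) x <-> evalp x q \is a GRing.unit.
Proof.
rewrite points_form1 /=.
have E (y : 'rV[R]_1) :
    solves [:: rename (lshift 1) q * 'X_(rshift n ord0) - 1] (row_mx x y) <->
    evalp x q * y 0 0 = 1.
  rewrite /solves /= andbT evalpB evalpM evalp1 evalpX evalp_rename row_mxEr.
  have -> : pullv (lshift 1) (row_mx x y) = x.
    by apply/rowP => i; rewrite mxE row_mxEl.
  by rewrite subr_eq0; split=> /eqP.
split=> [[y /E h]|u].
  by apply/unitrPr; exists (y 0 0).
exists (const_mx (evalp x q)^-1); apply/E.
by rewrite mxE mulrV.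
Qed.

(** The class of the locally closed subscheme of s = 0 where q is invertible. *)
Definition open_class n (s : schemic F n) (q : {mpoly F[n]}) : GrformL F :=
  fclass (formM (scheme_form s) (unit_form q)).

(** The class of the empty scheme.  It need not vanish: the scissor relations
    and the jet relations are all compatible with sending every generator to 1.
    It is only an absorbing idempotent for the classes of formularies. *)
Definition empty_class : GrformL F := sclass ([:: 1] : schemic F 0).

Lemma no_points1 R n (x : 'rV[R]_n) : ~ solves [:: 1 : {mpoly F[n]}] x.
Proof. by rewrite /solves /= andbT evalp1 oner_eq0. Qed.

Lemma fclass_empty n (Phi : formulary F n) :
  (forall R (x : 'rV[R]_n), ~ points Phi x) -> fclass Phi = empty_class.
Proof.
move=> Phi0; apply: fclass_iso; exists [::], [::] => R.
exists (fun=> 0), (fun=> 0); split=> [x|y|x y|y x].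
- by move/Phi0.
- by move/points_scheme/no_points1.
- by move/Phi0.
- by move/points_scheme/no_points1.
Qed.

Lemma empty_classM n (Phi : formulary F n) :
  empty_class * fclass Phi = empty_class.
Proof.
rewrite -fclassX; apply: fclass_empty => R x.
by case/points_formX => /points_scheme/no_points1.
Qed.

(** The cut-and-paste relation for a closed subscheme.  Over a local Artinian
    ring the value of q is a unit or nilpotent.  The points of the second kind
    form the total jet along q = 0, which has the class of the closed subscheme
    q = 0 itself.  The two pieces are disjoint, hence the corrective term. *)
Lemma sclass_cut n (s : schemic F n) (q : {mpoly F[n]}) :
  sclass s = open_class s q + sclass (q :: s) - empty_class.
Proof.
have /fclass_jet <- : forall p, ideal_of s p -> ideal_of (q :: s) p.
  move=> p; elim=> [u us||u v _ hu _ hv|b u _ hu].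
  - by apply: ideal_gen; rewrite inE us orbT.
  - exact: ideal0.
  - exact: idealD.
  - exact: idealM.
rewrite -fclass_scissor [X in _ + X - _]fclass_empty ?addrK; last first.
  move=> R x /points_formM[/points_formM[_ /points_unit u]] /points_jet[_ [k]].
  by move/eqP; apply/negP; apply: contraTneq (unitrX k u) => ->; rewrite unitr0.
apply: fclass_equiv => R x; split=> [/points_scheme sx|].
  apply/points_formU; case: (art_unit_or_nilp (evalp x q)) => [u|nil].
    by left; apply/points_formM; split; [apply/points_scheme|apply/points_unit].
  by right; apply/points_jet.
case/points_formU=> [/points_formM[]//|/points_jet[sx _]].
exact/points_scheme.
Qed.

Lemma Lef_affine k : sclass ([::] : schemic F k) = Lef ^+ k.
Proof.
have E j : fclass (scheme_form ([::] : schemic F j.+1)) =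
    Lef * fclass (scheme_form ([::] : schemic F j)).
  rewrite [Lef]/(fclass (scheme_form ([::] : schemic F 1))) -fclassX.
  apply: (@fclass_equiv (1 + j)) => R x; split=> _; last exact/points_scheme.
  by apply/points_formX; split; apply/points_scheme.
rewrite /sclass; elim: k => [|k IH]; last by rewrite exprS -IH E.
rewrite expr0.
transitivity (toLocalize (lefschetz F) 1); last exact: toLocalize1.
apply: (congr1 (toLocalize (lefschetz F))).
exact: (qr_pi1 (idealQuot_pre (@form_rel F))).
Qed.

Lemma solves_coords R n (Z : {set 'I_n}) (x : 'rV[R]_n) :
  solves [seq 'X_i | i <- enum Z] x <-> forall i, i \in Z -> x 0 i = 0.
Proof.
rewrite /solves all_map; split=> [/allP h i iZ|h].
  by have /= := h i; rewrite mem_enum evalpX => /(_ iZ)/eqP.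
by apply/allP => i; rewrite mem_enum /= evalpX => /h ->.
Qed.

(** Coordinates that are free contribute a factor Lef each, and coordinates
    that are set to zero do not contribute. *)
Lemma fclass_cylinder n m (f : 'I_m -> 'I_n) (Z : {set 'I_n})
    (Phi : formulary F n) (Psi : formulary F m) :
  injective f -> (forall i, f i \notin Z) ->
  (forall R (x : 'rV[R]_n), points Phi x <->
     (forall i, i \in Z -> x 0 i = 0) /\ points Psi (pullv f x)) ->
  fclass Phi = Lef ^+ (n - m - #|Z|) * fclass Psi.
Proof.
move=> finj fZ PhiP.
pose U := ~: (Z :|: [set f i | i in 'I_m]).
have cU : #|U| = (n - m - #|Z|)%N.
  rewrite cardsCs setCK cardsU card_ord card_imset // card_ord.
  rewrite (_ : Z :&: [set f i | i in 'I_m] = set0).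
    by rewrite cards0 subn0 addnC subnDA.
  apply/setP => i; rewrite !inE; apply/negP => /andP[iZ /imsetP[j _ ij]].
  by have := fZ j; rewrite -ij iZ.
rewrite -cU -Lef_affine mulrC -fclassX.
pose g (i : 'I_(m + #|U|)) :=
  match split i with inl j => f j | inr j => enum_val j end.
have gl j : g (lshift _ j) = f j by rewrite /g splitL.
have gr j : g (rshift _ j) = enum_val j by rewrite /g splitR.
apply/fclass_iso/(@schemic_iso_pullv _ _ _ _ g [seq 'X_i | i <- enum Z]).
  move=> R x.
  rewrite solves_coords PhiP.
  have E : pullv (lshift #|U|) (pullv g x) = pullv f x.
    by rewrite pullv_comp; apply: eq_pullv => j /=; rewrite gl.
  split=> -[h1 h2]; split=> //.
    by apply/points_formX; split; [rewrite E|apply/points_scheme].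
  by case/points_formX: h2; rewrite E.
move=> R y _.
have cover i : i \notin Z -> exists j, g j = i.
  move=> iZ; have [/imsetP[j _ ->]|iN] := boolP (i \in [set f i | i in 'I_m]).
    by exists (lshift _ j).
  have iU : i \in U by rewrite !inE negb_or iZ iN.
  by exists (rshift _ (enum_rank_in iU i)); rewrite gr enum_rankK_in.
have ginj : injective g.
  move=> i j; rewrite -[i]splitK -[j]splitK.
  case: (split i) (split j) => [u|u] [v|v] /=; rewrite ?gl ?gr.
  - by move/finj ->.
  - move=> uv; have := enum_valP v; rewrite -uv !inE imset_f ?orbT //.
  - move=> uv; have := enum_valP u; rewrite uv !inE imset_f ?orbT //.
  - by move/enum_val_inj ->.
have gZ j : g j \notin Z.
  rewrite -[j]splitK; case: (split j) => u /=; rewrite ?gl ?gr //.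
  by have := enum_valP u; rewrite !inE negb_or => /andP[].
exists (\row_i if [pick j | g j == i] is Some j then y 0 j else 0).
have E : pullv g
    (\row_i (if [pick j | g j == i] is Some j then y 0 j else 0)) = y.
  apply/rowP => j; rewrite !mxE; case: pickP => [k /eqP/ginj -> //|].
  by move/(_ j); rewrite eqxx.
split=> [|x [/solves_coords xZ xy]].
  split=> //; apply/solves_coords => i iZ; rewrite mxE.
  by case: pickP => // j /eqP ji; have := gZ j; rewrite ji iZ.
apply/rowP => i; rewrite mxE; case: pickP => [j /eqP <-|ng].
  by rewrite -xy mxE.
by rewrite xZ //; apply: contraT => /cover[j ji]; have := ng j; rewrite ji eqxx.
Qed.

Definition upd R n (z : 'I_n) (x : 'rV[R]_n) (t : R) : 'rV[R]_n :=
  \row_i if i == z then t else x 0 i.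

(** One equation that determines the variable z uniquely divides the class of a
    cylinder along z by Lef: the fibre line is recovered by letting the value of
    an auxiliary variable replace z. *)
Lemma fclass_eliminate n (z : 'I_n) (q : {mpoly F[n]})
    (Phi Psi : formulary F n) :
  (forall R (x : 'rV[R]_n), points Psi x <-> evalp x q = 0 /\ points Phi x) ->
  (forall R (x : 'rV[R]_n) t, points Phi x -> points Phi (upd z x t)) ->
  (forall R (x : 'rV[R]_n), points Phi x ->
     exists! t, evalp (upd z x t) q = 0) ->
  Lef * fclass Psi = fclass Phi.
Proof.
move=> PsiP Phiz qP.
have <- : fclass (formX Psi (scheme_form ([::] : schemic F 1))) =
    Lef * fclass Psi.
  by rewrite fclassX mulrC.
pose f (i : 'I_n) : 'I_(n + 1) := if i == z then rshift n 0 else lshift 1 i.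
have fE R (x : 'rV[R]_(n + 1)) :
    pullv f x = upd z (pullv (lshift 1) x) (x 0 (rshift n 0)).
  by apply/rowP => i; rewrite !mxE /f; case: eqP.
have updK R (x : 'rV[R]_n) t : upd z (upd z x t) (x 0 z) = x.
  by apply/rowP => i; rewrite !mxE; case: eqP => // ->.
have updupd R (x : 'rV[R]_n) t t' : upd z (upd z x t) t' = upd z x t'.
  by apply/rowP => i; rewrite !mxE; case: eqP.
apply/fclass_iso/(@schemic_iso_pullv _ _ _ _ f [:: rename (lshift 1) q]).
  move=> R x; rewrite points_formX PsiP /solves /= andbT evalp_rename.
  rewrite fE; split=> [[[h1 h2] _]|[/eqP h1 h2]].
    by split; [apply/eqP|apply: Phiz].
  split; last exact/points_scheme; split=> //.
  by rewrite -(updK _ (pullv _ _) (x 0 (rshift n 0))); apply: Phiz.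
move=> R y py; have [t [tq tu]] := qP _ _ py.
exists (row_mx (upd z y t) (const_mx (y 0 z))); split.
  rewrite /solves /= andbT evalp_rename fE row_mxEr mxE.
  have -> : pullv (lshift 1) (row_mx (upd z y t) (const_mx (y 0 z))) =
      upd z y t.
    by apply/rowP => i; rewrite mxE row_mxEl.
  by rewrite tq eqxx updK.
move=> x [sx xy]; move: sx; rewrite /solves /= andbT evalp_rename => /eqP sx.
have xE : pullv (lshift 1) x = upd z y (x 0 (lshift 1 z)).
  apply/rowP => i; rewrite -xy fE !mxE; by case: eqP => // ->.
rewrite xE in sx; apply/rowP => i; rewrite -[i]splitK.
case: (split i) => j /=; rewrite ?row_mxEl ?row_mxEr ?mxE.
  by rewrite (tu _ sx); move/rowP: xE => /(_ j); rewrite !mxE.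
by rewrite -xy fE mxE eqxx (ord1 j).
Qed.

End Classes.

(** * Powers of truncated series *)

Section PolyPower.
Variable R : comNzRingType.
Implicit Types (p : {poly R}).

Lemma low_coef0_drop p l : (forall k, (k < l)%N -> p`_k = 0) ->
  p = drop_poly l p * 'X^l.
Proof.
move=> pl; rewrite -[LHS](poly_take_drop l).
rewrite [take_poly l p](_ : _ = 0) ?add0r //.
by apply/polyP => k; rewrite coef_take_poly coef0; case: ifP => // /pl.
Qed.

Lemma coef_exp_low p l b t : (forall k, (k < l)%N -> p`_k = 0) ->
  (t < b * l)%N -> (p ^+ b)`_t = 0.
Proof.
by move=> /low_coef0_drop -> tl; rewrite exprMn -exprM coefMXn mulnC tl.
Qed.

Lemma coef0_exp p b : (p ^+ b)`_0 = p`_0 ^+ b.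
Proof. by rewrite -!horner_coef0 horner_exp. Qed.

Lemma coef_exp_lead p l b : (forall k, (k < l)%N -> p`_k = 0) ->
  (p ^+ b)`_(b * l) = p`_l ^+ b.
Proof.
move=> /low_coef0_drop pE; rewrite [in LHS]pE exprMn -exprM coefMXn mulnC.
by rewrite ltnn subnn coef0_exp coef_drop_poly add0n.
Qed.

Lemma coef_exp_perturb0 p d s b : (0 < s)%N ->
  exists c, [/\ (p + d *: 'X^s) ^+ b = p ^+ b + c * 'X^s
    & c`_0 = b%:R * p`_0 ^+ b.-1 * d].
Proof.
move=> s0; elim: b => [|b [c [IH c0]]].
  by exists 0; rewrite !expr0 mul0r addr0 coef0 !mul0r.
exists (c * p + d *: p ^+ b + d *: (c * 'X^s)); split.
  by rewrite !exprSr IH -!mul_polyC; ring.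
rewrite !coefD !coefZ coefMXn s0 mulr0 addr0 coef0M c0 coef0_exp /=.
case: b {IH c0} => [|b] /=; first by rewrite !expr0; ring.
by rewrite !exprS; ring.
Qed.

(** For p of order at least l, changing the coefficient of index l + s leaves
    p ^+ b unchanged below index b * l + s, where the dependence is affine with
    slope b * p_l ^+ b.-1; positivity of s removes the terms of degree > 1 in
    d. *)
Lemma coef_exp_perturb p d s l b : (0 < s)%N -> (0 < b)%N ->
    (forall k, (k < l)%N -> p`_k = 0) ->
  (forall t, (t < b * l + s)%N -> ((p + d *: 'X^(l + s)) ^+ b)`_t = (p ^+ b)`_t)
  /\ ((p + d *: 'X^(l + s)) ^+ b)`_(b * l + s) =
     (p ^+ b)`_(b * l + s) + b%:R * p`_l ^+ b.-1 * d.
Proof.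
move=> s0 b0 /low_coef0_drop pE; set p' := drop_poly l p in pE.
have E : (p + d *: 'X^(l + s)) ^+ b = (p' + d *: 'X^s) ^+ b * 'X^(b * l).
  by rewrite {1}pE addnC exprD scalerAl -mulrDl exprMn -exprM mulnC.
have E' : p ^+ b = p' ^+ b * 'X^(b * l) by rewrite {1}pE exprMn -exprM mulnC.
have [c [cE c0]] := coef_exp_perturb0 p' d b s0.
have p0 : p'`_0 = p`_l by rewrite coef_drop_poly.
split=> [t tl|].
  rewrite E E' cE !coefMXn; case: ltnP => // bl.
  by rewrite coefD coefMXn ltn_subLR // tl addr0.
rewrite E E' cE !coefMXn ltnNge leq_addr /= addnC addnK.
rewrite coefD coefMXn ltnn subnn.
by rewrite c0 p0.
Qed.

End PolyPower.

(** * Strata of the arc schemes of a power hypersurface *)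

Section Arcs.
Variables (F : fieldType) (m : nat) (r : 'I_m -> F) (a : 'I_m -> nat).
Implicit Types (R : artAlg F) (n : nat).

Definition arc_series R n (x : 'rV[R]_(n * m)) (i : 'I_m) : {poly R} :=
  \poly_(j < n) (if insub j is Some j' then x 0 (mxvec_index j' i) else 0).

Definition power_series R (P : 'I_m -> {poly R}) : {poly R} :=
  \sum_i (r i)%:A *: P i ^+ a i.

Lemma arc_series_coef R n (x : 'rV[R]_(n * m)) i (j : 'I_n) :
  (arc_series x i)`_j = x 0 (mxvec_index j i).
Proof. by rewrite coef_poly ltn_ord valK. Qed.

Lemma arc_series_coef0 R n (x : 'rV[R]_(n * m)) i l : (n <= l)%N ->
  (arc_series x i)`_l = 0.
Proof. by move=> nl; rewrite coef_poly ltnNge nl. Qed.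

Lemma arc_seriesE R n (x : 'rV[R]_(n * m)) i :
  arc_series x i = \sum_(j < n) x 0 (mxvec_index j i) *: 'X^j.
Proof.
by rewrite /arc_series poly_def; apply: eq_bigr => j _; rewrite valK.
Qed.

Definition arc_coord n (l : nat) (i : 'I_m) : {mpoly F[n * m]} :=
  (\sum_(j < n) 'X_(mxvec_index j i) *: 'X^j : {poly {mpoly F[n * m]}})`_l.

Lemma evalp_coef R n k (x : 'rV[R]_k) (P : {poly {mpoly F[k]}}) :
  evalp x P`_n = (map_poly (mmap (in_alg R) (fun i => x 0 i)) P)`_n.
Proof. by rewrite coef_map. Qed.

Lemma map_arcvar R n (x : 'rV[R]_(n * m)) i :
  map_poly (mmap (in_alg R) (fun i => x 0 i))
   (\sum_(j < n) 'X_(mxvec_index j i) *: 'X^j) = arc_series x i.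
Proof.
rewrite arc_seriesE rmorph_sum; apply: eq_bigr => j _ /=.
by rewrite map_polyZ map_polyXn; congr (_ *: _); exact: evalpX.
Qed.

Lemma evalp_arc_coord R n (x : 'rV[R]_(n * m)) l i :
  evalp x (arc_coord n l i) = (arc_series x i)`_l.
Proof. by rewrite /arc_coord evalp_coef map_arcvar. Qed.

Lemma evalp_arc_poly R n (x : 'rV[R]_(n * m)) l :
  evalp x (arc_poly n (power_poly r a))`_l = (power_series (arc_series x))`_l.
Proof.
rewrite evalp_coef; congr (_`_l).
rewrite /arc_poly /power_poly.
pose h i : {poly {mpoly F[n * m]}} := \sum_(j < n) 'X_(mxvec_index j i) *: 'X^j.
have -> : mmap (fun c => (c%:MP)%:P) h (\sum_(i < m) r i *: 'X_i ^+ a i) =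
  \sum_i (r i)%:MP *: h i ^+ a i.
  rewrite (rmorph_sum (mmap (polyC \o @mpolyC _ F) h)); apply: eq_bigr => i _.
  transitivity ((r i)%:MP%:P * mmap (polyC \o @mpolyC _ F) h ('X_i ^+ a i)).
    exact: mmapZ.
  rewrite (rmorphXn (mmap (polyC \o @mpolyC _ F) h)) mul_polyC.
  by congr (_ *: _ ^+ _); rewrite /= mmapX mmap1U.
rewrite /power_series raddf_sum; under eq_bigr => i _.
  rewrite /= map_polyZ rmorphXn /= map_arcvar.
  rewrite [mmap _ _ _]mmapC.
  over.
by [].
Qed.

Definition arc_eqs n k : schemic F (n * m) :=
  [seq (arc_poly n (power_poly r a))`_t | t <- iota 0 k].

(** Arcs of length n on which k (rather than n) coefficients of the equation
    vanish, with the coordinates listed in Z set to zero; (l, i) stands for the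
    coefficient of index l of the i-th series. *)
Definition stratum n k (Z : seq (nat * 'I_m)) : schemic F (n * m) :=
  [seq arc_coord n p.1 p.2 | p <- Z] ++ arc_eqs n k.

Lemma solves_stratum R n k Z (x : 'rV[R]_(n * m)) :
  solves (stratum n k Z) x <->
  (forall p, p \in Z -> (arc_series x p.2)`_p.1 = 0) /\
  (forall t, (t < k)%N -> (power_series (arc_series x))`_t = 0).
Proof.
rewrite solves_cat /solves !all_map; split=> [/andP[/allP h1 /allP h2]|[h1 h2]].
  split=> [p /h1|t tk] /=; first by rewrite evalp_arc_coord => /eqP.
  have := h2 t; rewrite mem_iota add0n tk => /(_ isT) /=.
  by rewrite evalp_arc_poly => /eqP.
apply/andP; split; apply/allP.
  by move=> p pZ /=; rewrite evalp_arc_coord; apply/eqP/h1.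
by move=> t; rewrite mem_iota add0n /= evalp_arc_poly => tk; apply/eqP/h2.
Qed.

Lemma coef_exp_trunc (A : comNzRingType) (p q : {poly A}) k b :
  (forall t, (t < k)%N -> p`_t = q`_t) ->
  forall t, (t < k)%N -> (p ^+ b)`_t = (q ^+ b)`_t.
Proof.
move=> pq; elim: b => [|b IH] t tk; first by rewrite !expr0.
rewrite !exprS !coefM; apply: eq_bigr => i _.
by rewrite pq ?IH // (leq_ltn_trans _ tk) // ?leq_subr // -ltnS.
Qed.

Lemma power_series_trunc R (P Q : 'I_m -> {poly R}) k :
  (forall i t, (t < k)%N -> (P i)`_t = (Q i)`_t) ->
  forall t, (t < k)%N -> (power_series P)`_t = (power_series Q)`_t.
Proof.
move=> PQ t tk; rewrite !coef_sum; apply: eq_bigr => i _; rewrite !coefZ.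
by congr (_ * _); apply: coef_exp_trunc tk => u; apply: PQ.
Qed.

Lemma mxvec_fun n k T (g : 'I_n -> 'I_k -> T) :
  exists f : 'I_(n * k) -> T, forall i j, f (mxvec_index i j) = g i j.
Proof.
by exists (mxvec (\matrix_(i, j) g i j) 0) => i j; rewrite mxvecE mxE.
Qed.

Lemma mxvec_index_inj n k (i i' : 'I_n) (j j' : 'I_k) :
  mxvec_index i j = mxvec_index i' j' -> i = i' /\ j = j'.
Proof. by move=> /cast_ord_inj/enum_rank_inj[-> ->]. Qed.

(** Coefficients of index < n of the equation do not see the m coordinates that
    are added when the length passes from n to n + 1. *)
Lemma open_class_more_coords n Z l (j : 'I_m) :
  (forall p, p \in Z -> p.1 < n)%N -> (l < n)%N ->
  open_class (stratum n.+1 n Z) (arc_coord n.+1 l j) =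
  Lef F ^+ m * open_class (stratum n n Z) (arc_coord n l j).
Proof.
move=> Zn ln.
have [f fE] := mxvec_fun (fun (i : 'I_n) (k : 'I_m) =>
  mxvec_index (widen_ord (leqnSn n) i) k).
have mE : m = (n.+1 * m - n * m - #|set0 : {set 'I_(n.+1 * m)}|)%N.
  by rewrite cards0 subn0 -mulnBl subSn // subnn mul1n.
rewrite [X in Lef F ^+ X]mE.
apply: (fclass_cylinder (f := f)) => [u v|i|R x].
- case/mxvec_indexP: u => u u'; case/mxvec_indexP: v => v v'.
  by rewrite !fE => /mxvec_index_inj[] /(congr1 val) /= /val_inj -> ->.
- by rewrite inE.
have S i t : (t < n)%N ->
    (arc_series (pullv f x) i)`_t = (arc_series x i)`_t.
  move=> tn; rewrite -[t]/(val (Ordinal tn)) arc_series_coef mxE fE.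
  by rewrite -arc_series_coef.
rewrite !points_formM !points_scheme !points_unit !solves_stratum.
rewrite !evalp_arc_coord S //.
split=> [[[h1 h2] h3]|[_ [[h1 h2] h3]]].
  split; first by move=> i; rewrite inE.
  split=> //; split=> [p pZ|t tn]; first by rewrite S ?h1 ?Zn.
  by rewrite (power_series_trunc S tn) h2.
split=> //; split=> [p pZ|t tn]; first by rewrite -S ?h1 ?Zn.
by rewrite -(power_series_trunc S tn) h2.
Qed.

Lemma arc_series_upd R n (x : 'rV[R]_(n * m)) (k : 'I_n) j t i :
  arc_series (upd (mxvec_index k j) x t) i =
  arc_series x i +
    (if i == j then t - x 0 (mxvec_index k j) else 0) *: 'X^k.
Proof.
apply/polyP => u; rewrite coefD coefZ coefXn.
have [un|nu] := ltnP u n; last first.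
  by rewrite !arc_series_coef0 // gtn_eqF ?mulr0 ?addr0 // (leq_trans _ nu).
rewrite -[u]/(val (Ordinal un)) !arc_series_coef mxE.
case: eqP => [/mxvec_index_inj[<- <-]|h].
  by rewrite !eqxx /= mulr1 addrC subrK.
case: (eqVneq i j) => [ij|_]; last by rewrite mul0r addr0.
case: eqP => [uk|_]; last by rewrite mulr0 addr0.
by case: h; rewrite ij; congr mxvec_index; apply: val_inj.
Qed.

(** The equation of index n is solved for the coordinate of index
    l + (n - a j * l) of the j-th series: it occurs there with the unit
    coefficient r j * a j * x_(l, j) ^+ (a j).-1 and occurs neither in the
    equations of lower index nor among the coordinates of Z. *)
Lemma open_class_eliminate n Z l (j : 'I_m) :
  r j != 0 -> (0 < a j)%N -> (a j)%:R != 0 :> F -> (a j * l < n)%N ->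
  (forall k, (k < l)%N -> (k, j) \in Z) ->
  (forall k, (k, j) \in Z -> (k <= l)%N) ->
  Lef F * open_class (stratum n.+1 n.+1 Z) (arc_coord n.+1 l j) =
  open_class (stratum n.+1 n Z) (arc_coord n.+1 l j).
Proof.
move=> rj a0 aj ln Zlow Zup.
pose s := (n - a j * l)%N.
have s0 : (0 < s)%N by rewrite subn_gt0.
have nE : (a j * l + s = n)%N by rewrite addnC subnK // ltnW.
have lsn : (l + s < n.+1)%N by rewrite ltnS -nE leq_add2r leq_pmull.
pose k := Ordinal lsn; pose z := mxvec_index k j.
have updE R (x : 'rV[R]_(n.+1 * m)) t i u : (i != j) || (u != l + s)%N ->
    (arc_series (upd z x t) i)`_u = (arc_series x i)`_u.
  move=> h; rewrite arc_series_upd coefD coefZ coefXn.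
  case/orP: h => /negbTE ->; first by rewrite mul0r addr0.
  by rewrite mulr0 addr0.
have change R (x : 'rV[R]_(n.+1 * m)) t :
    (forall p, p \in Z -> (arc_series x p.2)`_p.1 = 0) ->
  (forall u, (u < n)%N -> (power_series (arc_series (upd z x t)))`_u =
     (power_series (arc_series x))`_u) /\
  (power_series (arc_series (upd z x t)))`_n =
    (power_series (arc_series x))`_n +
    (r j * (a j)%:R)%:A * (arc_series x j)`_l ^+ (a j).-1 * (t - x 0 z).
  move=> xZ; have low u : (u < l)%N -> (arc_series x j)`_u = 0.
    by move=> /Zlow/xZ.
  have [E1 E2] := coef_exp_perturb (t - x 0 z) s0 a0 low.
  rewrite nE in E1 E2.
  have D u : (power_series (arc_series (upd z x t)))`_u =
    (power_series (arc_series x))`_u + (r j)%:A *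
      (((arc_series x j + (t - x 0 z) *: 'X^(l + s)) ^+ a j)`_u -
        (arc_series x j ^+ a j)`_u).
    rewrite !coef_sum (bigD1 j) // [in RHS](bigD1 j) //= !coefZ.
    rewrite arc_series_upd eqxx -/z /=.
    rewrite [X in _ + X = _](eq_bigr
      (fun i => ((r i)%:A *: arc_series x i ^+ a i)`_u)).
      by ring.
    by move=> i /negbTE ij; rewrite arc_series_upd ij scale0r addr0.
  split=> [u un|]; first by rewrite D E1 // subrr mulr0 addr0.
  rewrite D E2; congr (_ + _); rewrite addrAC subrr add0r !mulrA.
  congr (_ * _ * _); rewrite -(rmorph_nat (in_alg R)) /=.
  by rewrite -scalerAl mul1r scalerA.
apply: (@fclass_eliminate _ _ z (arc_poly n.+1 (power_poly r a))`_n).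
- move=> R x; rewrite evalp_arc_poly !points_formM !points_scheme.
  rewrite !solves_stratum; split=> [[[h1 h2] h3]|[h0 [[h1 h2] h3]]].
    split; first by apply: h2.
    by split=> //; split=> // t tn; apply/h2/ltnW.
  split=> //; split=> // t; rewrite ltnS leq_eqVlt => /orP[/eqP -> //|].
  exact: h2.
- move=> R x t; rewrite !points_formM !points_scheme !points_unit.
  rewrite !solves_stratum !evalp_arc_coord => -[[h1 h2] h3]; split; last first.
    by rewrite updE // -{1}[l]addn0 eqn_add2l eq_sym -lt0n s0 orbT.
  have [E1 _] := change R x t h1; split=> [[l' i] pZ /=|u un].
    rewrite updE ?(h1 (l', i)) //; case: eqP => //= ij.
    rewrite ij in pZ; rewrite ltn_eqF //.
    by rewrite (leq_ltn_trans (Zup _ pZ)) // -{1}[l]addn0 ltn_add2l.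
  by rewrite E1 ?h2.
move=> R x; rewrite !points_formM !points_scheme !points_unit.
rewrite !solves_stratum !evalp_arc_coord => -[[h1 h2] h3].
set c := (r j * (a j)%:R)%:A * (arc_series x j)`_l ^+ (a j).-1.
have cu : c \is a GRing.unit.
  rewrite unitrM unitrX // andbT.
  by apply: (rmorph_unit (in_alg R)); rewrite unitfE mulf_neq0.
have E t := (change R x t h1).2.
exists (x 0 z - c^-1 * (power_series (arc_series x))`_n); split.
  rewrite evalp_arc_poly E -/c addrAC subrr sub0r mulrN mulrA mulrV //.
  by rewrite mul1r subrr.
move=> t; rewrite evalp_arc_poly E -/c => /eqP.
rewrite addrC addr_eq0 => /eqP h.
by rewrite -mulrN -h mulrA mulVr // mul1r addrC subrK.
Qed.

(** A stratum on which x_(l, j) is a unit and a j is nonzero in F behaves as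
    the arcs of a smooth variety of dimension m - 1. *)
Lemma open_class_separable n Z l (j : 'I_m) :
  r j != 0 -> (0 < a j)%N -> (a j)%:R != 0 :> F -> (a j * l < n)%N ->
  (forall p, p \in Z -> p.1 < n)%N ->
  (forall k, (k < l)%N -> (k, j) \in Z) ->
  (forall k, (k, j) \in Z -> (k <= l)%N) ->
  open_class (stratum n.+1 n.+1 Z) (arc_coord n.+1 l j) =
  Lef F ^+ m.-1 * open_class (stratum n n Z) (arc_coord n l j).
Proof.
move=> rj a0 aj ln Zn Zlow Zup; apply: Lef_mulI.
rewrite open_class_eliminate // open_class_more_coords //; last first.
  by rewrite (leq_ltn_trans _ ln) // leq_pmull.
by rewrite mulrA -exprS prednK // (leq_trans _ (ltn_ord j)).
Qed.

(** If the other series have high enough order, the coefficient of index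
    a k * l of the equation reduces to r k * x_(l, k) ^+ a k, which is
    incompatible with x_(l, k) being a unit. *)
Lemma open_class_inseparable n Z l (k : 'I_m) :
  (forall i, 0 < a i)%N -> r k != 0 -> (a k * l < n)%N ->
  (forall u, (u < l)%N -> (u, k) \in Z) ->
  (forall i u, i != k -> (a i * u <= a k * l)%N -> (u, i) \in Z) ->
  open_class (stratum n n Z) (arc_coord n l k) = empty_class F.
Proof.
move=> a0 rk ln Zk Zi; apply: fclass_empty => R x.
rewrite !points_formM !points_scheme !points_unit.
rewrite !solves_stratum !evalp_arc_coord => -[[h1 h2] h3].
have := h2 _ ln; rewrite coef_sum (bigD1 k) //=.
rewrite big1 ?addr0 => [|i ik]; last first.
  rewrite coefZ.
  suff -> : ((arc_series x i ^+ a i)`_(a k * l)) = 0 by rewrite mulr0.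
  have [u uE] : exists u, (a k * l < a i * u)%N /\
      (forall u', (u' < u)%N -> (a i * u' <= a k * l)%N).
    exists (a k * l %/ a i).+1; split.
      by rewrite [(a i * _)%N]mulnC -ltn_divLR.
    by move=> u'; rewrite ltnS leq_divRL // [(a i * _)%N]mulnC.
  apply: (@coef_exp_low _ _ u); last exact: uE.1.
  by move=> u' /uE.2 h; apply: (h1 (u', i)); apply: Zi.
rewrite coefZ coef_exp_lead; last by move=> u /Zk/h1.
move=> h; have : (r k)%:A * (arc_series x k)`_l ^+ a k \is a GRing.unit.
  rewrite unitrM unitrX // andbT.
  by apply: (rmorph_unit (in_alg R)); rewrite unitfE.
by rewrite h unitr0.
Qed.
End Arcs.

Section Recurrence.
Variables (F : fieldType) (m : nat) (r : 'I_m -> F) (a : 'I_m -> nat).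
Implicit Types (R : artAlg F) (n : nat).

(** If every x_i has order at least d i = e / a i, write x_i = 'X^(d i) * y_i.
    The equation becomes 'X^e times the equation in the y_i, of which only the
    coefficients of index < n matter; e - d i coefficients of y_i stay free. *)
Lemma sclass_shift (e : nat) (d : 'I_m -> nat) n (Z : seq (nat * 'I_m)) :
  (forall i, 0 < a i)%N -> (forall i, a i * d i = e)%N ->
  (forall l i, ((l, i) \in Z) = (l < d i)%N) ->
  sclass (stratum r a (n + e) (n + e) Z) =
  Lef F ^+ (\sum_i (e - d i)) * sclass (stratum r a n n [::]).
Proof.
move=> a0 ad ZP.
have de i : (d i <= e)%N by rewrite -(ad i) leq_pmull.
have ltje (j : 'I_n) i : (j + d i < n + e)%N by rewrite -addSn leq_add.
have [f fE] := mxvec_fun (fun (j : 'I_n) (i : 'I_m) =>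
  mxvec_index (Ordinal (ltje j i)) i).
pose U := [set p : 'I_(n + e) * 'I_m | (p.1 < d p.2)%N].
pose Y := [set mxvec_index p.1 p.2 | p in U].
have YP (j : 'I_(n + e)) i : (mxvec_index j i \in Y) = (j < d i)%N.
  apply/imsetP/idP => [[[j' i'] + /mxvec_index_inj[-> ->]]|ji].
    by rewrite inE.
  by exists (j, i); rewrite ?inE.
have cY : #|Y| = (\sum_i d i)%N.
  rewrite card_imset; last by move=> [? ?] [? ?] /mxvec_index_inj[/= -> ->].
  rewrite -sum1_card (eq_bigl (fun p : 'I_(n + e) * 'I_m =>
    xpredT p.1 && (p.1 < d p.2)%N)); last first.
    by move=> p; rewrite inE.
  rewrite -(pair_big_dep xpredT (fun (j : 'I_(n + e)) i => (j < d i)%N)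
    (fun _ _ => 1%N)) /=.
  rewrite (exchange_big_dep xpredT) //=; apply: eq_bigr => i _.
  rewrite sum1_card.
  rewrite -[RHS]card_ord -(card_image
    (f := widen_ord (leq_trans (de i) (leq_addl n e)))); last first.
    by move=> u v /(congr1 val) /= /val_inj.
  apply: eq_card => j; rewrite [LHS]/in_mem /=.
  apply/idP/imageP => [ji|[u _ ->]].
    by exists (Ordinal ji) => //; apply: val_inj.
  exact: (ltn_ord u).
have dimE : (\sum_i (e - d i) = (n + e) * m - n * m - #|Y|)%N.
  rewrite cY -mulnBl addKn sumnB // sum_nat_const card_ord mulnC //.
rewrite dimE; apply: (fclass_cylinder (f := f)) => [u v|u|R x].
- case/mxvec_indexP: u => u u'; case/mxvec_indexP: v => v v'.
  rewrite !fE => /mxvec_index_inj[] /(congr1 val) /= + uv; rewrite uv.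
  by move=> /addIn/val_inj ->.
- case/mxvec_indexP: u => u u'; rewrite fE YP /= -leqNgt leq_addl //.
have S i t : (t < n)%N ->
    (arc_series (pullv f x) i)`_t = (arc_series x i)`_(t + d i).
  move=> tn; rewrite -[t]/(val (Ordinal tn)) arc_series_coef mxE fE.
  rewrite -[(_ + d i)%N]/(val (Ordinal (ltje (Ordinal tn) i))).
  by rewrite arc_series_coef.
rewrite !points_scheme !solves_stratum.
have ZE : (forall p, p \in Z -> (arc_series x p.2)`_p.1 = 0) <->
    (forall k, k \in Y -> x 0 k = 0).
  split=> h.
    move=> k; case/mxvec_indexP: k => j i; rewrite YP => ji.
    by rewrite -arc_series_coef; apply: (h (nat_of_ord j, i)); rewrite ZP.
  move=> [l i]; rewrite ZP /= => li.
  have ln : (l < n + e)%N.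
    by rewrite (leq_trans li) // (leq_trans (de i)) // leq_addl.
  by rewrite -[l]/(val (Ordinal ln)) arc_series_coef h // YP.
have PE : (forall k, k \in Y -> x 0 k = 0) -> forall t, (t < n)%N ->
    (power_series r a (arc_series x))`_(t + e) =
    (power_series r a (arc_series (pullv f x)))`_t.
  move=> /ZE h t tn.
  have -> : power_series r a (arc_series x) =
      power_series r a (fun i => drop_poly (d i) (arc_series x i)) * 'X^e.
    rewrite /power_series mulr_suml; apply: eq_bigr => i _.
    rewrite -scalerAl; congr (_ *: _).
    rewrite -[X in 'X^X](ad i) mulnC exprM -exprMn.
    congr (_ ^+ _); apply: low_coef0_drop => k ki.
    by apply: (h (k, i)); rewrite ZP.
  rewrite coefMXn ltnNge leq_addl /= addnK.
  apply: power_series_trunc tn => i u un.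
  by rewrite coef_drop_poly S.
have P0 : (forall k, k \in Y -> x 0 k = 0) -> forall t, (t < e)%N ->
    (power_series r a (arc_series x))`_t = 0.
  move=> /ZE h t te; rewrite coef_sum big1 // => i _; rewrite coefZ.
  rewrite (@coef_exp_low _ _ (d i)) ?mulr0 ?ad // => k ki.
  by apply: (h (k, i)); rewrite ZP.
split=> [[/ZE h1 h2]|[h1 [_ h2]]].
  split=> //; split=> // t tn; rewrite -PE // h2 //.
  by rewrite ltn_add2r.
split; first exact/ZE.
move=> t tn; have [te|et] := ltnP t e; first exact: P0.
by rewrite -(subnK et) PE ?h2 // -(ltn_add2r e) subnK.
Qed.

(** The order in which coordinates are tested for being a unit: by the index
    a i * l at which they enter the equation, and, at equal index, exponents
    that are divisible by the characteristic last, so that the hypotheses of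
    open_class_inseparable hold when their turn comes. *)
Definition coord_key (p : nat * 'I_m) : nat :=
  (2 * (a p.2 * p.1) + (((a p.2)%:R : F) == 0)%R)%N.

(** Arcs are cut successively by the coordinates (l, i) with l < d i.  Each open
    piece, less the corrective term, gets multiplied by Lef ^+ m.-1 when n
    increases by one, and what remains at the end is Lef ^+ N times the arcs of
    length n. *)
Lemma igu_recurrence (e : nat) (d : 'I_m -> nat) n :
  (forall i, 0 < a i)%N -> (forall i, a i * d i = e)%N ->
  (forall i, r i != 0) ->
  (forall i j, (a i)%:R = 0 :> F -> (a j)%:R = 0 :> F -> i = j) ->
  let I k := sclass (stratum r a k k [::]) in
  let N := (\sum_i (e - d i))%N in
  I (n.+1 + e)%N - Lef F ^+ N * I n.+1 =
  Lef F ^+ m.-1 * (I (n + e)%N - Lef F ^+ N * I n).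
Proof.
move=> a0 ad r0 bad I N.
pose W := [seq (l, i) | i <- enum 'I_m, l <- iota 0 (d i)].
have WP l i : ((l, i) \in W) = (l < d i)%N.
  apply/allpairsPdep/idP => [[i' [l' [_ + [-> ->]]]]|ld].
    by rewrite mem_iota.
  by exists i, l; rewrite mem_enum mem_iota.
pose le p q := (coord_key p <= coord_key q)%N.
pose Ws := sort le W.
(* Z: coordinates already set to zero; Y: those still to be tested, by
   increasing key. *)
suff : forall Y Z : seq (nat * 'I_m),
    (forall p, (p \in W) = (p \in Z) || (p \in Y)) -> pairwise le Y ->
    (forall z y, z \in Z -> y \in Y -> le z y) ->
    sclass (stratum r a (n.+1 + e) (n.+1 + e) Z) - Lef F ^+ N * I n.+1 =
    Lef F ^+ m.-1 * (sclass (stratum r a (n + e) (n + e) Z) - Lef F ^+ N * I n).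
  move/(_ Ws [::]); apply=> //; first by move=> p; rewrite mem_sort.
  rewrite -sorted_pairwise; last by move=> u v w; apply: leq_trans.
  by apply: sort_sorted => u v; apply: leq_total.
elim=> [|[l j] Y IH] Z WZ.
  move=> _ _; have ZP u i : ((u, i) \in Z) = (u < d i)%N.
    by rewrite -WP WZ in_nil orbF.
  by rewrite !(sclass_shift _ a0 ad ZP) -/N -/(I n) -/(I n.+1) !subrr mulr0.
rewrite pairwise_cons => /andP[/allP leY pwY] leZ.
have lW : (l, j) \in W by rewrite WZ mem_head orbT.
have inZ p : p \in W -> (coord_key p < coord_key (l, j))%N -> p \in Z.
  rewrite WZ => /orP[//|pY]; rewrite ltnNge; case/negP.
  by move: pY; rewrite inE => /predU1P[-> //|/leY].
have v_lt : (a j * l < e)%N by rewrite -(ad j) ltn_pmul2l // -WP.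
have lowZ k : (k < l)%N -> (k, j) \in Z.
  move=> kl; apply: inZ; first by move: lW; rewrite !WP; apply: ltn_trans.
  by rewrite /coord_key /= ltn_add2r ltn_pmul2l // ltn_pmul2l.
have cutE k : sclass (stratum r a k k ((l, j) :: Z)) =
    sclass (stratum r a k k Z) -
    (open_class (stratum r a k k Z) (arc_coord F k l j) - empty_class F).
  have E : sclass (stratum r a k k Z) =
    open_class (stratum r a k k Z) (arc_coord F k l j) +
    sclass (stratum r a k k ((l, j) :: Z)) - empty_class F := sclass_cut _ _.
  by rewrite E; ring.
have openE : open_class (stratum r a (n.+1 + e) (n.+1 + e) Z)
                        (arc_coord F (n.+1 + e) l j) - empty_class F =
  Lef F ^+ m.-1 * (open_class (stratum r a (n + e) (n + e) Z)
                        (arc_coord F (n + e) l j) - empty_class F).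
  have [aj|aj] := eqVneq ((a j)%:R : F) 0.
    have B k : (e <= k)%N -> open_class (stratum r a k k Z) (arc_coord F k l j)
       = empty_class F.
      move=> ek; apply: open_class_inseparable => //; first exact: leq_trans ek.
      move=> i u ij au; apply: inZ.
        rewrite WP -(ltn_pmul2l (a0 i)) ad; exact: leq_ltn_trans v_lt.
      have ai : (a i)%:R != 0 :> F by apply: contraNneq ij => /bad/(_ aj) ->.
      rewrite /coord_key /= aj eqxx (negbTE ai) addn0 addn1.
      by rewrite ltnS leq_mul2l au.
    by rewrite !B ?leq_addl // subrr mulr0.
  rewrite mulrBr; have -> : Lef F ^+ m.-1 * empty_class F = empty_class F.
    by rewrite mulrC -Lef_affine empty_classM.
  congr (_ - _); apply: (@open_class_separable _ _ _ _ (n + e)) => //.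
  - by rewrite (leq_trans v_lt) ?leq_addl.
  - move=> [u i] uZ /=; have : (u, i) \in W by rewrite WZ uZ.
    rewrite WP => /leq_trans; apply; rewrite (leq_trans _ (leq_addl n e)) //.
    by rewrite -(ad i) leq_pmull.
  - move=> k kZ; have := leZ _ _ kZ (mem_head _ _).
    by rewrite /le /coord_key /= leq_add2r leq_pmul2l // leq_pmul2l.
have {IH} := IH ((l, j) :: Z); rewrite (cutE (n.+1 + e)%N) (cutE (n + e)%N).
rewrite openE => IH; have {}IH := IH _ pwY _.
have x_eq (A : comPzRingType) (c x y u v w : A) :
    x - c * w - u = c * (y - w - v) -> x - u = c * (y - v).
  by move=> h; rewrite -[LHS](addrNK (c * w)) [x - u - _]addrAC h; ring.
apply: x_eq (IH _ _).
- by move=> p; rewrite WZ !inE orbA [(p \in Z) || _]orbC.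
- move=> z y; rewrite inE => /predU1P[-> /leY //|zZ yY].
  by apply: leZ => //; rewrite inE yY orbT.
Qed.

End Recurrence.

(** * Rationality of the generating series *)

Section PowerSeriesQuotient.
Variable R : comPzRingType.
Implicit Types (f g : nat -> R) (c d : R).

Lemma ps_mul_one_sub c k f n : (0 < k)%N ->
  ps_mul (ps_one_sub c k) f n =
  f n - (if (k <= n)%N then c * f (n - k)%N else 0).
Proof.
move=> k0; rewrite /ps_mul.
rewrite (eq_bigr (fun i : 'I_n.+1 => (val i == 0%N)%:R * f (n - i)%N -
    (if val i == k then c * f (n - i)%N else 0))).
  rewrite sumrB; congr (_ - _).
    rewrite big_ord_recl /= mul1r subn0 big1 ?addr0 // => i _.
    by rewrite mul0r.
  rewrite -big_mkcond /=; case: ifP => kn.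
    by rewrite (big_pred1 (Ordinal (kn : (k < n.+1)%N))).
  rewrite big1 // => i /eqP ik; move: kn; rewrite -ik.
  by rewrite -ltnS ltn_ord.
move=> i _; rewrite /ps_one_sub mulrBl; congr (_ - _).
by case: eqP; rewrite ?mulr0n ?mul0r.
Qed.

Lemma ps_mul_one_sub1 c f g n :
  ps_mul (ps_mul (ps_one_sub c 1) f) g n.+1 =
  ps_mul f g n.+1 - c * ps_mul f g n.
Proof.
rewrite /ps_mul big_ord_recl [in RHS]big_ord_recl /=.
rewrite -![\sum_(i < _) ps_one_sub _ _ _ * _]/(ps_mul (ps_one_sub c 1) f _).
rewrite ps_mul_one_sub //= subr0 -addrA; congr (_ + _).
rewrite mulr_sumr -sumrB; apply: eq_bigr => i _.
rewrite -[\sum_(i < _) ps_one_sub _ _ _ * _]/(ps_mul (ps_one_sub c 1) f _).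
by rewrite ps_mul_one_sub //= /bump leq0n add1n subn1 subSS mulrBl mulrA.
Qed.

(** The hypothesis says that the product of g with both factors of the
    denominator has no coefficient of index > k. *)
Lemma ps_quotient_rat c d k (g : nat -> R) : (0 < k)%N ->
  (forall n, g (n.+1 + k)%N - d * g n.+1 = c * (g (n + k)%N - d * g n)) ->
  exists Q : seq R,
    ps_quotient (ps_poly Q) (ps_mul (ps_one_sub c 1) (ps_one_sub d k)) g.
Proof.
move=> k0 gP.
pose h := ps_mul (ps_mul (ps_one_sub c 1) (ps_one_sub d k)) g.
exists (mkseq h k.+1); split.
  rewrite ps_mul_one_sub //= subr0 /ps_one_sub eqxx.
  by rewrite eq_sym (gtn_eqF k0) mulr0n subr0.
move=> n; rewrite /ps_poly; have [nk|kn] := ltnP n k.+1.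
  by rewrite nth_mkseq.
rewrite nth_default ?size_mkseq //.
case: n kn => // n; rewrite ltnS => kn.
rewrite ps_mul_one_sub1 !ps_mul_one_sub // kn (leqW kn).
have := gP (n - k)%N; rewrite addSn subnK // -subSn // => ->.
by rewrite subrr.
Qed.

End PowerSeriesQuotient.

(** * Consequences of the isolated singularity *)

Section Singular.
Variables (F : closedFieldType) (m : nat) (r : 'I_m -> F) (a : 'I_m -> nat).

(** A monomial curve through the origin that consists of singular points is
    constant: a function g that does not vanish at the origin does not vanish
    at a general point of the curve. *)
Lemma isolated_singularity_curve (f : {mpoly F[m]}) (c : 'I_m -> F)
    (w : 'I_m -> nat) :
  isolated_singularity f (fun=> 0) -> (forall i, 0 < w i)%N ->
  (forall t, singular_point f (fun i => c i * t ^+ w i)) ->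
  forall i, c i = 0.
Proof.
move=> [_ [g g0 gP]] w0 sing i.
pose h : {poly F} := mmap polyC (fun i => (c i)%:P * 'X^(w i)) g.
have hE t : h.[t] = g.@[fun i => c i * t ^+ w i].
  rewrite /h /meval /mmap horner_sum; apply: eq_bigr => k _ /=.
  rewrite hornerM hornerC; congr (_ * _); rewrite /mmap1 horner_prod.
  by apply: eq_bigr => l _; rewrite !(hornerE, horner_exp).
have [t] : exists t, ~~ root (h * 'X) t.
  apply/closed_nonrootP; rewrite mulf_neq0 ?polyX_eq0 //.
  apply: contraNneq g0 => h0; have := hE 0; rewrite h0 horner0 => E.
  apply/eqP; rewrite [RHS]E; apply: meval_eq => k.
  by rewrite expr0n gtn_eqF ?w0 ?mulr0.
rewrite rootE !hornerE mulf_eq0 negb_or hE => /andP[/gP/(_ (sing t)) ct t0].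
by move/eqP: (ct i); rewrite mulf_eq0 expf_eq0 (negbTE t0) andbF orbF => /eqP.
Qed.

Lemma power_poly_eval (y : 'I_m -> F) :
  (power_poly r a).@[y] = \sum_i r i * y i ^+ a i.
Proof.
rewrite /power_poly raddf_sum; apply: eq_bigr => i _.
by rewrite /= mevalZ rmorphXn /= mevalXU.
Qed.

Lemma power_poly_deriv (y : 'I_m -> F) k :
  ((power_poly r a)^`M(k)).@[y] = r k * (a k)%:R * y k ^+ (a k).-1.
Proof.
rewrite /power_poly (raddf_sum (mderiv k)) (raddf_sum (meval y)).
rewrite (bigD1 k) //= big1 ?addr0 => [|i ik].
  rewrite mderivZ mpolyXn mderivX mevalZ mevalZ mevalX -mulrA.
  congr (_ * (_ * _)); first by rewrite mulmnE mnm1E eqxx mul1n.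
  rewrite (bigD1 k) //= big1 ?mulr1 => [|i ik].
    by rewrite mnmBE mulmnE mnm1E eqxx mul1n subn1.
  by rewrite mnmBE mulmnE mnm1E eq_sym (negbTE ik) mul0n expr0.
rewrite mderivZ mpolyXn mderivX mulmnE mnm1E (negbTE ik) mul0n.
by rewrite scale0r scaler0 meval0.
Qed.

Hypothesis a_gt0 : forall i, (0 < a i)%N.
Hypothesis sing0 : isolated_singularity (power_poly r a) (fun=> 0).

Lemma deriv_at0 i : r i * (a i)%:R * 0 ^+ (a i).-1 = 0.
Proof. by have [[_ /(_ i)]] := sing0; rewrite power_poly_deriv. Qed.

(** Otherwise the i-th coordinate axis is singular. *)
Lemma power_coef_neq0 i : r i != 0.
Proof.
apply/eqP => ri0; have /eqP := oner_neq0 F; apply.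
pose c k : F := (k == i)%:R.
have -> : 1 = c i by rewrite /c eqxx.
apply: (isolated_singularity_curve (w := fun=> 1%N) sing0) => // t; split.
  rewrite power_poly_eval big1 // => k _; rewrite /c.
  case: eqP => [->|_]; first by rewrite ri0 mul0r.
  by rewrite mul0r expr0n gtn_eqF ?mulr0.
move=> k; rewrite power_poly_deriv /c.
case: eqP => [->|_]; first by rewrite ri0 !mul0r.
by rewrite mul0r deriv_at0.
Qed.

(** If the characteristic divides both a i and a j, then the plane curve
    r i * y_i ^+ a i + r j * y_j ^+ a j = 0 is singular everywhere; it contains
    the monomial curve y_i = t ^+ a j, y_j = b * t ^+ a i. *)
Lemma inseparable_exponent_uniq i j :
  (a i)%:R = 0 :> F -> (a j)%:R = 0 :> F -> i = j.
Proof.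
move=> ai aj; apply/eqP; apply: contraT => ij.
have [b bE] : exists b, b ^+ a j = - (r i / r j).
  have /closed_rootP[b] :
      size ('X^(a j) - (- (r i / r j))%:P : {poly F}) != 1%N.
    by rewrite size_XnsubC // eqSS -lt0n.
  by rewrite rootE !hornerE subr_eq0 => /eqP bE; exists b.
have /eqP := oner_neq0 F; case.
pose c k : F := if k == i then 1 else if k == j then b else 0.
pose w k := if k == i then a j else if k == j then a i else 1%N.
have -> : 1 = c i by rewrite /c eqxx.
have jiF : (j == i) = false by rewrite eq_sym (negbTE ij).
apply: (isolated_singularity_curve (w := w) sing0) => [k|t].
  by rewrite /w; case: eqP => // _; case: eqP.
have zero k : k != i -> k != j -> c k * t ^+ w k = 0.
  by move=> /negbTE ki /negbTE kj; rewrite /c ki kj mul0r.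
split.
  rewrite power_poly_eval (bigD1 i) // (bigD1 j) /=; last by rewrite jiF.
  rewrite big1 ?addr0 => [|k /andP[ki kj]]; last first.
    by rewrite zero // expr0n gtn_eqF ?mulr0.
  rewrite /c /w !eqxx jiF mul1r exprMn bE -!exprM [(a i * _)%N]mulnC.
  by rewrite mulrA mulrN mulrCA divff ?power_coef_neq0 // mulr1 mulNr subrr.
move=> k; rewrite power_poly_deriv.
have [->|ki] := eqVneq k i; first by rewrite ai mulr0 mul0r.
have [->|kj] := eqVneq k j; first by rewrite aj mulr0 mul0r.
by rewrite zero // deriv_at0.
Qed.

End Singular.

(** * The zeta series *)

Theorem corollary9p14 (F : closedFieldType) (m : nat)
    (r : 'I_m -> F) (a : 'I_m -> nat)
    (m_gt0 : (0 < m)%N) (a_gt0 : forall i, (0 < a i)%N)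
    (sing0 : isolated_singularity (power_poly r a) (fun=> 0)) :
  let X : schemic F m := [:: power_poly r a] in
  let e := (\big[lcmn/1]_(i < m) a i)%N in
  let L : GrformL F := toLocalize (lefschetz F) (lefschetz F) in
  exists N : nat,
    N%:R = e%:R * (\sum_(i < m) ((a i)%:R - 1) / (a i)%:R) :> rat /\
    exists Q : seq (GrformL F),
      ps_quotient (ps_poly Q)
        (ps_mul (ps_one_sub (L ^+ m.-1) 1) (ps_one_sub (L ^+ N) e))
        (fun n => toLocalize (lefschetz F) (igu_geom X n)).
Proof.
move=> X e L.
pose d i := (e %/ a i)%N.
have ad i : (a i * d i = e)%N by rewrite mulnC divnK // (biglcmn_sup i).
have e_gt0 : (0 < e)%N.
  by apply: (big_ind (fun n => 0 < n)%N) => // u v; rewrite lcmn_gt0 => -> ->.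
exists (\sum_i (e - d i))%N; split.
  rewrite natr_sum mulr_sumr; apply: eq_bigr => i _.
  rewrite natrB; last by rewrite leq_div.
  have ai0 : (a i)%:R != 0 :> rat by rewrite Num.Theory.pnatr_eq0 -lt0n.
  by rewrite -(ad i) natrM; field.
apply: ps_quotient_rat => // n.
have IE k : toLocalize (lefschetz F) (igu_geom X k) =
    sclass (stratum r a k k [::]).
  by rewrite /igu_geom /linear_arc /= cats0.
rewrite !IE; apply: igu_recurrence => //; first exact: power_coef_neq0.
move=> i j; exact: (inseparable_exponent_uniq a_gt0 sing0).
Qed.
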